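(* Let $N\ge 2$, $\alpha\in(0,1)$, and let $\Omega\subset\mathbb{R}^N$ be an open and bounded set which is convex in the $x_1$ direction and symmetric with respect to the plane $x_1=0$. Let $f:[0,\infty)\to\mathbb{R}$ be locally Lipschitz, and let $g:\Omega\to\mathbb{R}$ be symmetric with respect to $x_1=0$ and decreasing in the $x_1$ direction for $x=(x_1,x')\in\Omega$, $x_1>0$. Let $u$ be a positive classical solution of $$(-\Delta)^{\alpha}u(x)=f(u(x))+g(x),\ x\in\Omega,\qquad u(x)=0,\ x\in\Omega^c=\mathbb{R}^N\setminus\Omega .$$ Then $u$ is symmetric with respect to the plane $x_1=0$ (that is, $u(-x_1,x')=u(x_1,x')$) and it is strictly decreasing in the $x_1$ direction for $x=(x_1,x')\in\Omega$, $x_1>0$.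
   Context: Points of $\mathbb{R}^N$ are written $x=(x_1,x')$ with $x_1\in\mathbb{R}$, $x'\in\mathbb{R}^{N-1}$. The set $\Omega$ is convex in the $x_1$ direction if $(x_1,x'),(y_1,x')\in\Omega$ implies $(tx_1+(1-t)y_1,x')\in\Omega$ for all $t\in(0,1)$. For $\alpha\in(0,1)$ the fractional Laplacian is $$(-\Delta)^\alpha u(x)=P.V.\int_{\mathbb{R}^N}\frac{u(x)-u(y)}{|x-y|^{N+2\alpha}}\,dy,$$ where $P.V.$ denotes the principal value at $y=x$. A classical solution is a continuous function $u:\mathbb{R}^N\to\mathbb{R}$ such that $(-\Delta)^\alpha u(x)$ is defined by this formula at every $x\in\Omega$ and such that the equation in $\Omega$ and the condition in $\Omega^c$ hold pointwise. Positive means $u>0$ in $\Omega$. ''Decreasing'' without the word ''strictly'' is understood in the non-strict sense. *)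

(* Defs.v *)
From HB Require Import structures.
From mathcomp Require Import all_boot all_order all_algebra.
From mathcomp Require Import all_classical all_reals all_analysis.

Set Implicit Arguments.
Unset Strict Implicit.
Unset Printing Implicit Defensive.

Import Order.TTheory GRing.Theory Num.Theory.
Import numFieldNormedType.Exports.

Local Open Scope classical_set_scope.
Local Open Scope ring_scope.

(* R^n is ['rV[R]_n], with the sigma-algebra generated by the coordinates
   (i.e. the Borel sigma-algebra). *)
Section measurable_rV.
Context {R : realType} (n : nat).

Let coord (i : 'I_n) (x : 'rV[R]_n) : measurableTypeR R := x ord0 i.

Let rV_set0 : g_sigma_preimage coord set0.
Proof. exact: sigma_algebra0. Qed.

Let rV_setC A : g_sigma_preimage coord A -> g_sigma_preimage coord (~` A).
Proof. exact: sigma_algebraC. Qed.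

Let rV_bigcup (F : (set 'rV[R]_n)^nat) :
  (forall i, g_sigma_preimage coord (F i)) ->
  g_sigma_preimage coord (\bigcup_i (F i)).
Proof. exact: sigma_algebra_bigcup. Qed.

HB.instance Definition _ := @isMeasurable.Build default_measure_display
  'rV[R]_n (g_sigma_preimage coord) rV_set0 rV_setC rV_bigcup.

Lemma measurable_coord (i : 'I_n) : measurable_fun [set: 'rV[R]_n] (coord i).
Proof.
move=> _ Y mY; rewrite setTI; apply: sub_sigma_algebra => /=.
rewrite -bigcup_seq/=; exists i => /=; first by rewrite mem_index_enum.
by exists Y => //; rewrite setTI.
Qed.

Lemma measurable_fun_coordP d (T : measurableType d) (f : T -> 'rV[R]_n) :
  (forall i, measurable_fun [set: T] (coord i \o f)) ->
  measurable_fun [set: T] f.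
Proof.
move=> mf; suff H : g_sigma_preimage (fun i => coord i \o f) `<=` measurable.
  move=> _ A mA; apply: H; rewrite g_sigma_preimage_comp.
  by exists A.
apply: smallest_sub; first exact: sigma_algebra_measurable.
rewrite -bigcup_seq; apply: bigcup_sub => i _ _ [B mB <-].
exact: mf.
Qed.

End measurable_rV.

(* [pt x1 x'] is the point (x1, x') of R^(n+1). *)
Definition pt {R : realType} {n : nat} (x1 : R) (x' : 'rV[R]_n) : 'rV[R]_n.+1 :=
  row_mx x1%:M x'.

Section lebesgue_rV.
Context {R : realType}.
Local Open Scope ereal_scope.

Lemma pt0 n (x1 : R) (x' : 'rV[R]_n) : pt x1 x' ord0 ord0 = x1.
Proof.
transitivity (row_mx x1%:M x' ord0 (@lshift 1 n ord0)); last first.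
  by rewrite row_mxEl mxE.
by congr (fun_of_matrix (row_mx _ _) _ _); exact: val_inj.
Qed.

Lemma pt_lift n (x1 : R) (x' : 'rV[R]_n) (i : 'I_n) :
  pt x1 x' ord0 (lift ord0 i) = x' ord0 i.
Proof.
transitivity (row_mx x1%:M x' ord0 (@rshift 1 n i)); last by rewrite row_mxEr.
by congr (fun_of_matrix (row_mx _ _) _ _); exact: val_inj.
Qed.

Let pair_pt n (x : measurableTypeR R * 'rV[R]_n) : 'rV[R]_n.+1 := pt x.1 x.2.

Let pt_pair n (x : 'rV[R]_n.+1) : measurableTypeR R * 'rV[R]_n :=
  (x ord0 ord0, \row_i x ord0 (lift ord0 i)).

Let pair_ptK n : cancel (@pair_pt n) (@pt_pair n).
Proof.
move=> [x1 x']; rewrite /pt_pair/= pt0; congr pair.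
by apply/rowP => i; rewrite mxE pt_lift.
Qed.

Lemma measurable_pt n :
  measurable_fun setT (fun x : measurableTypeR R * 'rV[R]_n => pt x.1 x.2).
Proof.
apply: measurable_fun_coordP => i.
case: (unliftP ord0 i) => [j|] ->.
  rewrite (_ : _ \o _ = (fun x : 'rV[R]_n => x ord0 j) \o snd).
    by apply: measurableT_comp => //; exact: measurable_coord.
  by apply/funext => x /=; rewrite pt_lift.
rewrite (_ : _ \o _ = fst); first exact: measurable_fst.
by apply/funext => x /=; rewrite pt0.
Qed.

Let measurable_pt_pair n : measurable_fun setT (@pt_pair n).
Proof.
apply/measurable_fun_pairP; split; first exact: (measurable_coord ord0).
apply: measurable_fun_coordP => i.
rewrite (_ : _ \o _ = fun x : 'rV[R]_n.+1 => x ord0 (lift ord0 i)).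
  exact: measurable_coord.
by apply/funext => x /=; rewrite mxE.
Qed.

Section step.
Variables (n : nat) (mu : {sigma_finite_measure set 'rV[R]_n -> \bar R}).

Definition lebesgue_rVS : set 'rV[R]_n.+1 -> \bar R :=
  pushforward (lebesgue_measure \x mu) (fun x => pt x.1 x.2).

Let lebesgue_rVS0 : lebesgue_rVS set0 = 0.
Proof. by rewrite /lebesgue_rVS /pushforward preimage_set0 measure0. Qed.

Let lebesgue_rVS_ge0 A : 0 <= lebesgue_rVS A.
Proof. by rewrite /lebesgue_rVS /pushforward measure_ge0. Qed.

Let lebesgue_rVS_sigma_additive : semi_sigma_additive lebesgue_rVS.
Proof.
have mpt := @measurable_pt n.
by rewrite /lebesgue_rVS; exact: measure_semi_sigma_additive.
Qed.

HB.instance Definition _ := isMeasure.Build _ _ _ lebesgue_rVS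
  lebesgue_rVS0 lebesgue_rVS_ge0 lebesgue_rVS_sigma_additive.

Let lebesgue_rVS_sigma_finite : sigma_finite setT lebesgue_rVS.
Proof.
have /sigma_finiteP[F [FT ndF Foo]] := sigma_finiteT (@lebesgue_measure R).
have /sigma_finiteP[G [GT ndG Goo]] := sigma_finiteT mu.
exists (fun k => @pt_pair n @^-1` (F k `*` G k)).
  apply/esym; rewrite -subTset => x _.
  have [i _ Fi] : (\bigcup_i F i) (pt_pair x).1 by rewrite -FT.
  have [j _ Gj] : (\bigcup_i G i) (pt_pair x).2 by rewrite -GT.
  exists (maxn i j) => //; split.
    by move: Fi; exact/subsetPset/ndF/leq_maxl.
  by move: Gj; exact/subsetPset/ndG/leq_maxr.
move=> k; have [mF Fk] := Foo k; have [mG Gk] := Goo k.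
split; first by rewrite -[X in measurable X]setTI; apply: measurable_pt_pair => //;
  exact: measurableX.
rewrite /lebesgue_rVS /pushforward -comp_preimage.
rewrite (_ : _ \o _ = id); last by apply/funext => x; exact: pair_ptK.
by rewrite preimage_id product_measure1E// lte_mul_pinfty// ge0_fin_numE.
Qed.

HB.instance Definition _ := Measure_isSigmaFinite.Build _ _ _ lebesgue_rVS
  lebesgue_rVS_sigma_finite.

End step.

(* Lebesgue measure on R^n, as the iterated product of the one on R. *)
Fixpoint lebesgue_rV (n : nat) : {sigma_finite_measure set 'rV[R]_n -> \bar R} :=
  match n with
  | 0 => \d_(0%R : 'rV[R]_0)
  | n'.+1 => lebesgue_rVS (lebesgue_rV n')
  end.

Lemma lebesgue_rV_box n (A : 'I_n -> set (measurableTypeR R)) :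
  (forall i, measurable (A i)) ->
  lebesgue_rV n [set x | forall i, A i (x ord0 i)] =
  \prod_(i < n) lebesgue_measure (A i).
Proof.
elim: n A => [|n IHn] A mA.
  by rewrite big_ord0/= diracE mem_set// => -[].
rewrite big_ord_recl -IHn; last by move=> i; exact: mA.
rewrite /= /lebesgue_rVS /pushforward.
rewrite [X in _ X = _](_ : _ = A ord0 `*`
    [set x : 'rV[R]_n | forall i, A (lift ord0 i) (x ord0 i)]).
  rewrite product_measure1E//.
  rewrite (_ : [set _ | _] = \bigcap_(i in [set: 'I_n])
      ((fun x : 'rV[R]_n => x ord0 i : measurableTypeR R)
         @^-1` A (lift ord0 i))).
    apply: fin_bigcap_measurable => // i _.
    by rewrite -[X in measurable X]setTI; exact: measurable_coord.
  by apply/seteqP; split=> [x Ax i _|x Ax i]; [exact: Ax|exact: (Ax i)].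
apply/seteqP; split=> [[x1 x'] /= H|[x1 x'] /= [H0 H] i].
  split; first by have := H ord0; rewrite pt0.
  by move=> i; have := H (lift ord0 i); rewrite pt_lift.
by case: (unliftP ord0 i) => [j|] ->; rewrite ?pt0 ?pt_lift.
Qed.

End lebesgue_rV.

Section fractional_laplacian.
Context {R : realType}.

(* The norm [`|x|] of the library on ['rV[R]_n] is the sup norm. *)
Definition enorm n (x : 'rV[R]_n) : R := Num.sqrt (\sum_i x ord0 i ^+ 2).

Definition fraclap_kernel n (alpha : R) (u : 'rV[R]_n -> R) (x y : 'rV[R]_n) : R :=
  (u x - u y) / enorm (x - y) `^ (n%:R + 2 * alpha).

Definition off_ball n (x : 'rV[R]_n) (e : R) : set 'rV[R]_n :=
  [set y | e <= enorm (x - y)].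

Definition fraclap_trunc n (alpha : R) (u : 'rV[R]_n -> R) (x : 'rV[R]_n)
    (e : R) : R :=
  \int[lebesgue_rV n]_(y in off_ball x e) fraclap_kernel alpha u x y.

(* The principal value exists as a finite limit of absolutely convergent
   integrals; [fraclap] is meaningful only under this condition. *)
Definition fraclap_defined n (alpha : R) (u : 'rV[R]_n -> R) (x : 'rV[R]_n) :=
  (forall e : R, 0 < e ->
     (lebesgue_rV n).-integrable (off_ball x e)
       (EFin \o fraclap_kernel alpha u x)) /\
  cvg (fraclap_trunc alpha u x e @[e --> 0^'+]).

Definition fraclap n (alpha : R) (u : 'rV[R]_n -> R) (x : 'rV[R]_n) : R :=
  lim (fraclap_trunc alpha u x e @[e --> 0^'+]).

Definition classical_solution n (alpha : R) (Omega : set 'rV[R]_n)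
    (f : R -> R) (g u : 'rV[R]_n -> R) :=
  [/\ continuous u,
      forall x, Omega x -> fraclap_defined alpha u x,
      forall x, Omega x -> fraclap alpha u x = f (u x) + g x &
      forall x, ~ Omega x -> u x = 0].

End fractional_laplacian.

Section x1_direction.
Context {R : realType} {n : nat}.
Implicit Types (D : set 'rV[R]_n.+1) (h : 'rV[R]_n.+1 -> R).

Definition convex_x1 D := forall (x1 y1 : R) (x' : 'rV[R]_n),
  D (pt x1 x') -> D (pt y1 x') ->
  forall t : R, 0 < t < 1 -> D (pt (t * x1 + (1 - t) * y1) x').

Definition symmetric_set_x1 D := forall (x1 : R) (x' : 'rV[R]_n),
  D (pt x1 x') -> D (pt (- x1) x').

(* [h] is symmetric on [D]; used with [D] stable under (x1, x') |-> (-x1, x'). *)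
Definition symmetric_x1 D h := forall (x1 : R) (x' : 'rV[R]_n),
  D (pt x1 x') -> h (pt (- x1) x') = h (pt x1 x').

Definition decreasing_x1 D h := forall (x1 y1 : R) (x' : 'rV[R]_n),
  D (pt x1 x') -> D (pt y1 x') -> 0 < x1 -> x1 < y1 ->
  h (pt y1 x') <= h (pt x1 x').

Definition strictly_decreasing_x1 D h := forall (x1 y1 : R) (x' : 'rV[R]_n),
  D (pt x1 x') -> D (pt y1 x') -> 0 < x1 -> x1 < y1 ->
  h (pt y1 x') < h (pt x1 x').

End x1_direction.

(* Main.v *)
Require Import Defs.
From mathcomp Require Import all_boot all_order all_algebra.
From mathcomp Require Import all_classical all_reals all_analysis.
From mathcomp Require Import measurable_realfun ring lra.

Set Implicit Arguments.
Unset Strict Implicit.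
Unset Printing Implicit Defensive.

Import Order.TTheory GRing.Theory Num.Theory.
Import numFieldNormedType.Exports.

Local Open Scope classical_set_scope.
Local Open Scope ring_scope.

(** The proof moves the plane [x1 = l] from the right towards [l = 0]. With
    [w x = u (refl l x) - u x], written [adiff u l x], the claim is that [w] is
    nonnegative to the right of the plane for every [l > 0]. At [l = 0], for [u] and
    for its mirror image ([classical_solution_refl]), this is the symmetry; for
    [l > 0], with a strong maximum principle, it is the strict monotonicity
    ([strictly_decreasing_solution]).

    The nonlocal operator is evaluated at a point [x] to the right of the plane. As
    [w] is odd under the reflection, the left half-space can be folded onto the right
    one ([antisym_trunc]): the difference of the fractional Laplacians of [u] at
    [refl l x] and at [x] is at most the limit of the integrals, over the right
    half-space off small balls, of
    [(w x - w y) * (ker p x y - ker p x (refl l y)) + 2 * w x * ker p x (refl l y)].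
    At a negative minimum of [w] the first term is nonpositive, and on a cube where
    [w] is positive it is bounded away from 0 ([ker_diff_ge], [positive_cube]); the second
    one is at most a multiple of [w x * d `^ (- (2 * alpha))], where [d] is the distance
    of [x] to the plane. By the equation, the same difference is at least [L * w x], where
    [L] is a Lipschitz constant of [f], provided that [g x <= g (refl l x)]. If [d] is
    small the second term contradicts this. If [d] is not small and [l] is only
    slightly smaller than a value at which [w] was known to be nonnegative, then [w x]
    is close to 0 and the first term does ([adiff_nonneg_open]). Hence the set of good
    values of [l], which is closed ([adiff_nonneg_closed]), is all of the positive
    half-line.

    The delicate point is the inequality for [g]. It holds unless the mirror image of
    [x] lies on [x1 = 0], that is, unless [x1 = 2 * l], and on that plane the values of
    [g] are arbitrary. The minimum must therefore be moved away from [x1 = 2 * l], by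
    minimising [w y - eps * `|y1 - 2 * l| `^ (2 * alpha)] with a small [eps]. The
    exponent is critical in both directions. At a minimum on the cusp, the truncated
    integrals would tend to minus infinity logarithmically, which the existence of
    the principal value excludes ([spike_integral_diverges], [no_spike_minimum]). At a
    minimum off the cusp, the perturbation costs at most [eps] times a constant,
    uniformly in the distance to the cusp ([spike_integral_le]), because second
    differences of the power satisfy a scale invariant lower bound
    ([second_difference_le]). *)

(** * The reflection and Lebesgue measure *)

Section reflection.
Context {R : realType} {n : nat}.
Implicit Types (l : R) (x y : 'rV[R]_n.+1).

Definition refl l x : 'rV[R]_n.+1 :=
  \row_i (if i == ord0 then 2 * l - x ord0 i else x ord0 i).

Lemma refl_0 l x : refl l x ord0 ord0 = 2 * l - x ord0 ord0.
Proof. by rewrite mxE eqxx. Qed.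

Lemma refl_S l x i : i != ord0 -> refl l x ord0 i = x ord0 i.
Proof. by move=> i0; rewrite mxE (negbTE i0). Qed.

Lemma reflK l : involutive (refl l).
Proof.
move=> x; apply/rowP => i; rewrite !mxE.
by case: (i == ord0) => //=; ring.
Qed.

Lemma refl_fixed l x : x ord0 ord0 = l -> refl l x = x.
Proof.
move=> xl; apply/rowP => i; case: (eqVneq i ord0) => [->|i0]; last by rewrite refl_S.
by rewrite refl_0 xl; ring.
Qed.

Lemma refl_pt l (a : R) (x' : 'rV[R]_n) : refl l (pt a x') = pt (2 * l - a) x'.
Proof.
apply/rowP => i; rewrite mxE; case: (unliftP ord0 i) => [j|] ->.
  by rewrite eq_sym (negbTE (neq_lift _ _)) !pt_lift.
by rewrite eqxx !pt0.
Qed.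

Lemma pt_eta x : x = pt (x ord0 ord0) (\row_i x ord0 (lift ord0 i)).
Proof.
apply/rowP => i; case: (unliftP ord0 i) => [j|] ->; last by rewrite pt0.
by rewrite pt_lift mxE.
Qed.

Lemma enorm_ge0 x : 0 <= enorm x.
Proof. exact: sqrtr_ge0. Qed.

Lemma enorm_sqr x : enorm x ^+ 2 = \sum_i x ord0 i ^+ 2.
Proof. by rewrite sqr_sqrtr// sumr_ge0// => i _; rewrite sqr_ge0. Qed.

Lemma enorm_refl2 l x y : enorm (refl l x - refl l y) = enorm (x - y).
Proof.
congr Num.sqrt; apply: eq_bigr => i _; rewrite !mxE.
by case: ifPn => // _; rewrite -sqrrN; congr (_ ^+ 2); ring.
Qed.

(** Reflecting [y] changes its squared distance to [x] by four times the product
    of the signed distances of [x] and [y] to the plane. The sign and the size of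
    every difference [ker p x y - ker p x (refl l y)] below come from this. *)
Lemma enorm_refl l x y : enorm (x - refl l y) ^+ 2 =
  enorm (x - y) ^+ 2 + 4 * (x ord0 ord0 - l) * (y ord0 ord0 - l).
Proof.
rewrite !enorm_sqr big_ord_recl [in RHS]big_ord_recl.
rewrite (eq_bigr (fun i : 'I_n => (x - y) ord0 (lift ord0 i) ^+ 2)).
  by rewrite !mxE/=; ring.
by move=> i _; rewrite !mxE eq_sym (negbTE (neq_lift _ _)).
Qed.

Lemma enorm_reflC l x y : enorm (refl l x - y) = enorm (x - refl l y).
Proof. by rewrite -(enorm_refl2 l) reflK. Qed.

Lemma coord_le_enorm x i : `|x ord0 i| <= enorm x.
Proof.
rewrite -sqrtr_sqr ler_wsqrtr// (bigD1 i)//= lerDl sumr_ge0// => j _.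
exact: sqr_ge0.
Qed.

Lemma enorm_le_coord x (r : R) : 0 <= r ->
  (forall i, `|x ord0 i| <= r) -> enorm x ^+ 2 <= n.+1%:R * r ^+ 2.
Proof.
move=> r0 xr; rewrite enorm_sqr.
rewrite (le_trans (ler_sum _ (G := fun=> r ^+ 2) _))//.
  by move=> i _; rewrite -[leLHS]ger0_norm ?sqr_ge0// normrX lerXn2r ?nnegrE.
by rewrite sumr_const card_ord -[leLHS]mulr_natl.
Qed.

Lemma measurable_refl l : measurable_fun [set: 'rV[R]_n.+1] (refl l).
Proof.
apply: measurable_fun_coordP => i.
rewrite (_ : _ \o _ = fun x : 'rV[R]_n.+1 =>
  if i == ord0 then 2 * l - x ord0 i else x ord0 i); last first.
  by apply/funext => x /=; rewrite mxE.
have [_|_] := boolP (i == ord0); last exact: measurable_coord.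
apply: measurable_funB => //; exact: measurable_coord.
Qed.

Lemma measurable_enorm : measurable_fun [set: 'rV[R]_n.+1] (@enorm R n.+1).
Proof.
apply: (@measurableT_comp _ _ _ _ _ _ (@Num.sqrt R)).
  by apply: continuous_measurable_fun; exact: sqrt_continuous.
apply: measurable_sum => i; apply: measurable_funX; exact: measurable_coord.
Qed.

Lemma measurable_enormB x : measurable_fun [set: 'rV[R]_n.+1] (fun y => enorm (x - y)).
Proof.
apply: (@measurableT_comp _ _ _ _ _ _ (@enorm R n.+1)).
  exact: measurable_enorm.
apply: measurable_fun_coordP => i.
rewrite (_ : _ \o _ = fun y : 'rV[R]_n.+1 => x ord0 i - y ord0 i).
  by apply: measurable_funB => //; exact: measurable_coord.
by apply/funext => y /=; rewrite !mxE.
Qed.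

End reflection.

Section invariance.
Context {R : realType} {n : nat}.
Local Open Scope ereal_scope.
Local Notation mu := (lebesgue_rV n.+1).

Lemma lebesgue_measure_refl1 (l : R) (A : set (measurableTypeR R)) :
  measurable A -> lebesgue_measure ((fun t : R => (2 * l - t)%R) @^-1` A) = lebesgue_measure A.
Proof.
move=> mA.
have mf : measurable_fun [set: measurableTypeR R]
    (fun t : R => (2 * l - t)%R : measurableTypeR R).
  by apply: measurable_funB.
transitivity (pushforward lebesgue_measure
  (fun t : measurableTypeR R => (2 * l - t)%R : measurableTypeR R) A) => //.
apply/esym/lebesgue_measure_unique => //= _ [[a b]] _ <-.
rewrite /pushforward.
rewrite (_ : _ @^-1` _ = `[(2 * l - b)%R, (2 * l - a)%R[%classic).
  rewrite !lebesgue_measure_itv/= !lte_fin ltrD2l ltrN2 -!EFinB.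
  by case: ifP => // _; congr EFin; ring.
by apply/seteqP; split=> t /=; rewrite !in_itv/= => /andP[? ?]; apply/andP; split; lra.
Qed.

(** In the coordinates given by [pt] the reflection acts on the first factor of a
    product measure only, so uniqueness of product measures reduces the claim to
    the line. *)
Lemma lebesgue_rV_refl (l : R) (A : set 'rV[R]_n.+1) : measurable A ->
  mu (refl l @^-1` A) = mu A.
Proof.
move=> mA.
pose r (t : measurableTypeR R) : measurableTypeR R := (2 * l - t)%R.
have mr : measurable_fun setT r by apply: measurable_funB.
pose h (z : measurableTypeR R * 'rV[R]_n) := (r z.1, z.2).
have mh : measurable_fun setT h.
  apply/measurable_fun_pairP; split; last exact: measurable_snd.
  exact: (measurableT_comp mr measurable_fst).
pose m2 := pushforward (lebesgue_measure \x lebesgue_rV n) h.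
have E := @product_measure_unique _ _ _ _ _ lebesgue_measure (lebesgue_rV n) m2.
rewrite /= /lebesgue_rVS /pushforward.
rewrite [RHS]E.
- rewrite /m2 /pushforward; congr (_ _).
  by apply/seteqP; split => -[t x'] /=; rewrite refl_pt.
- move=> B C mB mC; rewrite /m2 /pushforward/=.
  transitivity ((lebesgue_measure \x lebesgue_rV n) ((r @^-1` B) `*` C)).
    by [].
  rewrite product_measure1E//; first by congr (_ * _); exact: lebesgue_measure_refl1.
  by rewrite -[X in measurable X]setTI; exact: mr.
- rewrite -[X in measurable X]setTI; exact: (@measurable_pt R n).
Qed.

Lemma ge0_integral_refl (l : R) (D : set 'rV[R]_n.+1) (F : 'rV[R]_n.+1 -> \bar R) :
  measurable D -> measurable_fun D F -> {in D, forall y, 0 <= F y} ->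
  \int[mu]_(y in D) F y = \int[mu]_(y in refl l @^-1` D) F (refl l y).
Proof.
move=> mD mF F0; rewrite -(ge0_integral_pushforward (measurable_refl l) mu mD mF F0).
apply: eq_measure_integral => [|mr A mA _]; first exact: measurable_refl.
by rewrite /= /pushforward lebesgue_rV_refl.
Qed.

Lemma measurable_preimage_refl (l : R) (D : set 'rV[R]_n.+1) :
  measurable D -> measurable (refl l @^-1` D).
Proof. by move=> mD; rewrite -[X in measurable X]setTI; exact: measurable_refl. Qed.

Lemma integrable_refl (l : R) (D : set 'rV[R]_n.+1) (F : 'rV[R]_n.+1 -> R) :
  measurable D -> mu.-integrable D (EFin \o F) ->
  mu.-integrable (refl l @^-1` D) (EFin \o (F \o refl l)).
Proof.
move=> mD /integrableP[mF iF]; apply/integrableP; split.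
  rewrite compA; apply: (measurable_comp (F := D)) => //.
    by move=> _ [y Dy <-].
  by apply: measurable_funTS; exact: measurable_refl.
rewrite -(@ge0_integral_refl l D (fun y => `|(F y)%:E|)) //.
by apply: measurableT_comp.
Qed.

Lemma Rintegral_refl (l : R) (D : set 'rV[R]_n.+1) (F : 'rV[R]_n.+1 -> R) :
  measurable D -> mu.-integrable D (EFin \o F) ->
  (\int[mu]_(y in D) F y = \int[mu]_(y in refl l @^-1` D) F (refl l y))%R.
Proof.
move=> mD iF; have /integrableP[mF _] := iF.
have mD' := measurable_preimage_refl l mD.
congr fine; rewrite integralE [in RHS]integralE; congr (_ - _).
  rewrite (@ge0_integral_refl l _ (EFin \o F)^\+)//; last exact: measurable_funepos.
  by apply: eq_integral => y _; rewrite !funeposE.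
rewrite (@ge0_integral_refl l _ (EFin \o F)^\-)//; last exact: measurable_funeneg.
by apply: eq_integral => y _; rewrite !funenegE.
Qed.

Lemma Rintegral_refl_stable (l : R) (D : set 'rV[R]_n.+1) (F : 'rV[R]_n.+1 -> R) :
  measurable D -> refl l @^-1` D = D -> mu.-integrable D (EFin \o F) ->
  (\int[mu]_(y in D) F y = \int[mu]_(y in D) (F \o refl l) y)%R.
Proof. by move=> mD E iF; rewrite (Rintegral_refl l mD iF) E. Qed.

End invariance.

(** * The kernel and antisymmetric differences *)

Section boxes.
Context {R : realType} {n : nat}.
Local Notation mu := (lebesgue_rV n.+1).
Implicit Types (a b x y : 'rV[R]_n.+1).

Definition obox a b : set 'rV[R]_n.+1 :=
  [set y | forall i, a ord0 i < y ord0 i < b ord0 i].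

Definition cube x (r : R) : set 'rV[R]_n.+1 := obox (x - const_mx r) (x + const_mx r).

Lemma cubeP x r y : cube x r y <-> forall i, `|x ord0 i - y ord0 i| < r.
Proof.
by split=> h i; move: (h i); rewrite !mxE distrC ltr_distl.
Qed.

Lemma measurable_coord_itv (i : 'I_n.+1) (J : interval R) :
  measurable [set y : 'rV[R]_n.+1 | y ord0 i \in J].
Proof.
have := @measurable_coord R n.+1 i measurableT ([set` J] : set (measurableTypeR R)).
by rewrite setTI; apply; exact: measurable_itv.
Qed.

Lemma measurable_obox a b : measurable (obox a b).
Proof.
rewrite (_ : obox a b = \bigcap_(i in [set: 'I_n.+1])
   [set y : 'rV[R]_n.+1 | y ord0 i \in `]a ord0 i, b ord0 i[ ]).
  by apply: fin_bigcap_measurable => // i _; exact: measurable_coord_itv.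
apply/seteqP; split => [y h i _ /=|y h i]; first by rewrite in_itv/=; exact: h.
by have := h i I; rewrite /= in_itv.
Qed.

Lemma mu_obox a b : (forall i, a ord0 i <= b ord0 i) ->
  mu (obox a b) = (\prod_(i < n.+1) (b ord0 i - a ord0 i))%:E.
Proof.
move=> ab.
pose A (i : 'I_n.+1) : set (measurableTypeR R) := `]a ord0 i, b ord0 i[%classic.
transitivity (mu [set y : 'rV[R]_n.+1 | forall i, A i (y ord0 i)]).
  by [].
apply: etrans (lebesgue_rV_box _) _ => [i|]; first exact: measurable_itv.
rewrite -prodEFin; apply: eq_bigr => i _; rewrite lebesgue_measure_itv/= lte_fin.
by case: ltgtP (ab i) => // -> _; rewrite subrr.
Qed.

Lemma mu_cube x r : 0 <= r -> mu (cube x r) = ((2 * r) ^+ n.+1)%:E.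
Proof.
move=> r0; rewrite mu_obox; last by move=> i; rewrite !mxE; lra.
rewrite (eq_bigr (fun=> 2 * r)); last by move=> i _; rewrite !mxE; ring.
by rewrite prodr_const card_ord.
Qed.

Lemma enorm_lt_cube x y (r : R) : enorm (x - y) < r -> cube x r y.
Proof.
move=> xyr; apply/cubeP => i; apply: le_lt_trans xyr.
by have := coord_le_enorm (x - y) i; rewrite !mxE.
Qed.

Lemma measurable_off_ball x (e : R) : measurable (off_ball x e).
Proof.
rewrite -[X in measurable X]setTI.
have := @measurable_enormB R n x measurableT `[e, +oo[%classic.
rewrite (_ : _ @^-1` _ = off_ball x e); last first.
  by apply/seteqP; split => y; rewrite /= in_itv/= andbT.
by apply; exact: measurable_itv.
Qed.

End boxes.
#[global] Hint Extern 0 (measurable (off_ball _ _)) =>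
  solve [exact: measurable_off_ball] : core.
#[global] Hint Extern 0 (measurable (obox _ _)) =>
  solve [exact: measurable_obox] : core.
#[global] Hint Extern 0 (measurable (cube _ _)) =>
  solve [exact: measurable_obox] : core.

Section bounded_integrals.
Context d (T : measurableType d) (R : realType).
Variable mu : {measure set T -> \bar R}.

Lemma integrable_bounded_fin (D : set T) (f : T -> R) (M : R) :
  measurable D -> (mu D < +oo)%E -> measurable_fun D f ->
  (forall y, D y -> `|f y| <= M) -> mu.-integrable D (EFin \o f).
Proof.
move=> mD fD mf fM; apply: measurable_bounded_integrable => //.
exists M; split; first exact: num_real.
by move=> N MN y Dy; apply: le_trans (ltW MN); exact: fM.
Qed.

Lemma integrable_cst_fin (D : set T) (c : R) :
  measurable D -> (mu D < +oo)%E -> mu.-integrable D (EFin \o cst c).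
Proof. by move=> mD fD; exact: (@integrable_bounded_fin _ _ `|c|). Qed.

Lemma ge0_Rintegral_le (D : set T) (f : T -> R) (M : R) :
  (forall y, D y -> 0 <= f y) ->
  (\int[mu]_(y in D) (f y)%:E <= M%:E)%E -> \int[mu]_(y in D) f y <= M.
Proof.
move=> f0 h; rewrite -lee_fin fineK// ge0_fin_numE.
  by apply: le_lt_trans h _; rewrite ltry.
by apply: integral_ge0 => y Dy; rewrite lee_fin f0.
Qed.

Lemma Rintegral_ge (D : set T) (f : T -> R) (M : R) :
  measurable D -> mu.-integrable D (EFin \o f) ->
  (M%:E <= \int[mu]_(y in D) (f y)%:E)%E -> M <= \int[mu]_(y in D) f y.
Proof. by move=> mD iF h; rewrite -lee_fin fineK//; exact: integrable_fin_num. Qed.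

End bounded_integrals.

Section kernel.
Context {R : realType} {n : nat}.
Local Notation mu := (lebesgue_rV n.+1).
Implicit Types (x y : 'rV[R]_n.+1) (l p : R).

(** For [p != 0] the value at [y = x] is 0, as [0^-1 = 0]; this is why comparisons
    of two kernels assume that [enorm (x - y)] is positive. *)
Definition ker p x y : R := (enorm (x - y) `^ p)^-1.

Lemma ker_ge0 p x y : 0 <= ker p x y.
Proof. by rewrite invr_ge0 powR_ge0. Qed.

Lemma ker_reflC p l x y : ker p (refl l x) y = ker p x (refl l y).
Proof. by rewrite /ker enorm_reflC. Qed.

Lemma ker_le p x y (r : R) : 0 < p -> 0 < r -> r <= enorm (x - y) ->
  ker p x y <= r `^ (- p).
Proof.
move=> p0 r0 rxy; rewrite powRN lef_pV2 ?posrE ?powR_gt0//.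
  by rewrite ge0_ler_powR ?nnegrE ?enorm_ge0// ltW.
exact: lt_le_trans rxy.
Qed.

Lemma ker_ge p x y (r : R) : 0 < p -> 0 < enorm (x - y) -> enorm (x - y) <= r ->
  r `^ (- p) <= ker p x y.
Proof.
move=> p0 r0 rxy; rewrite powRN lef_pV2 ?posrE ?powR_gt0//.
  by rewrite ge0_ler_powR ?nnegrE ?enorm_ge0// ?ltW// (lt_le_trans r0).
exact: lt_le_trans rxy.
Qed.

Lemma enorm_refl_ge l x y : l <= x ord0 ord0 -> l <= y ord0 ord0 ->
  enorm (x - y) <= enorm (x - refl l y).
Proof.
move=> lx ly; rewrite -ler_sqr ?nnegrE ?enorm_ge0// enorm_refl lerDl.
by rewrite mulr_ge0 ?mulr_ge0// subr_ge0.
Qed.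

(** On the side of the plane that contains [x], the kernel prefers a point to its
    mirror image: this is what replaces the local maximum principle. *)
Lemma ker_anti p l x y : 0 < p -> l <= x ord0 ord0 -> l <= y ord0 ord0 ->
  0 < enorm (x - y) -> ker p x (refl l y) <= ker p x y.
Proof.
move=> p0 lx ly xy; have := enorm_refl_ge lx ly.
by move=> /(ker_le p0 xy) /le_trans; apply; rewrite powRN.
Qed.

Lemma measurable_ker p x : measurable_fun [set: 'rV[R]_n.+1] (ker p x).
Proof.
rewrite (_ : ker p x = (fun t : R => t `^ (- p)) \o (fun y => enorm (x - y))).
  apply: measurableT_comp; last exact: measurable_enormB.
  exact: measurable_powR.
by apply/funext => y /=; rewrite powRN.
Qed.

Lemma enorm_refl_dist l x y : l <= x ord0 ord0 -> l <= y ord0 ord0 ->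
  x ord0 ord0 - l <= enorm (x - refl l y).
Proof.
move=> lx ly; apply: le_trans (coord_le_enorm _ ord0).
by rewrite !mxE eqxx; apply: le_trans (ler_norm _); lra.
Qed.

End kernel.

(** The function called w in the method of moving planes; the goal is its sign
    to the right of the plane. It is odd under the reflection. *)
Definition adiff {R : realType} {n} (u : 'rV[R]_n.+1 -> R) (l : R) y : R := u (refl l y) - u y.

Lemma adiff_refl {R : realType} {n} (u : 'rV[R]_n.+1 -> R) (l : R) y :
  adiff u l (refl l y) = - adiff u l y.
Proof. by rewrite /adiff reflK opprB. Qed.

Section antisymmetric.
Context {R : realType} {n : nat}.
Local Notation mu := (lebesgue_rV n.+1).
Variables (alpha : R) (u : 'rV[R]_n.+1 -> R) (l : R) (x : 'rV[R]_n.+1).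
Local Notation p := (n.+1%:R + 2 * alpha).
Hypothesis p0 : 0 < p.
Hypothesis lx : l < x ord0 ord0.
Hypothesis dx : fraclap_defined alpha u x.
Hypothesis drx : fraclap_defined alpha u (refl l x).

Local Notation w := (adiff u l).

Definition halfsp : set 'rV[R]_n.+1 := [set y | l < y ord0 ord0].

Lemma measurable_halfsp : measurable halfsp.
Proof.
have := @measurable_coord_itv R n ord0 `]l, +oo[.
rewrite (_ : [set _ | _] = halfsp)//.
by apply/seteqP; split => y; rewrite /= in_itv/= andbT.
Qed.

Lemma off_ball_refl (e : R) : refl l @^-1` (off_ball (refl l x) e) = off_ball x e.
Proof. by apply/seteqP; split => y; rewrite /off_ball/= enorm_refl2. Qed.

Definition adiff_kernel y := (w x - w y) * ker p x y.
Local Notation F := adiff_kernel.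

Lemma adiff_kernelE y : fraclap_kernel alpha u (refl l x) (refl l y) -
  fraclap_kernel alpha u x y = F y.
Proof.
rewrite /F /fraclap_kernel/ker enorm_refl2 /adiff -mulrBl; congr (_ * _).
by move: (u _) (u _) (u _) (u _) => a b c d; ring.
Qed.

Lemma integrable_diff (e : R) : 0 < e -> mu.-integrable (off_ball x e) (EFin \o F).
Proof.
move=> e0; have [/(_ e e0) i1 _] := dx; have [/(_ e e0) i2 _] := drx.
have := integrable_refl l (measurable_off_ball _ _) i2.
rewrite off_ball_refl => i3; have := integrableB (measurable_off_ball _ _) i3 i1.
by apply: eq_integrable => // y _ /=; rewrite -EFinB adiff_kernelE.
Qed.

(** The reflection is an isometry that preserves the measure, so it carries the
    truncated integral around [refl l x] to one over the off-ball around [x]. *)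
Lemma trunc_diff (e : R) : 0 < e ->
  fraclap_trunc alpha u (refl l x) e - fraclap_trunc alpha u x e =
  \int[mu]_(y in off_ball x e) F y.
Proof.
move=> e0; have [/(_ e e0) i1 _] := dx; have [/(_ e e0) i2 _] := drx.
have i3 := integrable_refl l (measurable_off_ball _ _) i2.
rewrite off_ball_refl in i3.
rewrite /fraclap_trunc (Rintegral_refl l (measurable_off_ball _ _) i2) off_ball_refl.
rewrite -(RintegralB (measurable_off_ball x e) i3 i1).
by apply: eq_Rintegral => y _; exact: adiff_kernelE.
Qed.

(** The integrand on the half-space [halfsp l] once the other half is folded onto
    it: as [adiff u l] is odd, the mirror image of [y] contributes
    [(w x + w y) * ker p x (refl l y)], which is regrouped here so that the first
    summand carries the nonnegative weight of [ker_anti]. *)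
Definition folded_kernel y := (w x - w y) * (ker p x y - ker p x (refl l y))
   + 2 * w x * ker p x (refl l y).

Lemma folded_kernelE y : folded_kernel y = F y + F (refl l y).
Proof.
rewrite /folded_kernel /F adiff_refl.
by move: (w x) (w y) (ker _ _ _) (ker _ _ _) => a b c d; ring.
Qed.

Section small.
Variable e : R.
Hypotheses (e0 : 0 < e) (ed : e <= x ord0 ord0 - l).

Local Notation D := (off_ball x e).

Let lowD : ~` halfsp `<=` D.
Proof.
move=> y /= /negP; rewrite -leNgt => yl.
rewrite /off_ball/=; apply: le_trans (coord_le_enorm _ ord0).
by rewrite !mxE; apply: le_trans (ler_norm _); move: ed yl; lra.
Qed.

Let low := [set y : 'rV[R]_n.+1 | y ord0 ord0 < l].

Let mlow : measurable low.
Proof.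
have := @measurable_coord_itv R n ord0 `]-oo, l[.
by rewrite (_ : [set _ | _] = low)//; apply/seteqP; split => y; rewrite /= in_itv.
Qed.

Let low_refl : refl l @^-1` low = halfsp.
Proof.
by apply/seteqP; split => y; rewrite /low /halfsp /= refl_0; lra.
Qed.

Let mH := measurable_halfsp.
Let mHD : measurable (halfsp `&` D).
Proof. by apply: measurableI => //; exact: measurable_off_ball. Qed.

Let iF := integrable_diff e0.

Let iFlow : mu.-integrable low (EFin \o F).
Proof.
apply: (integrableS _ _ _ iF) => //; apply: subset_trans lowD.
by move=> y; rewrite /low /halfsp/= => yl; apply/negP; rewrite -leNgt ltW.
Qed.

Let iF' : mu.-integrable halfsp (EFin \o (F \o refl l)).
Proof. by rewrite -low_refl; exact: integrable_refl. Qed.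

Let iHF : mu.-integrable (halfsp `&` D) (EFin \o F).
Proof. by apply: (integrableS _ _ _ iF) => //; exact: subIsetr. Qed.

Let iHF' : mu.-integrable (halfsp `&` D) (EFin \o (F \o refl l)).
Proof. by apply: (integrableS _ _ _ iF') => //; exact: subIsetl. Qed.

Lemma integrable_folded : mu.-integrable (halfsp `&` D) (EFin \o folded_kernel).
Proof.
have := integrableD mHD iHF iHF'.
by apply: eq_integrable => // y _ /=; rewrite folded_kernelE.
Qed.

(** The off-ball contains the whole left half-space but misses a small ball on the
    right. Folding therefore leaves an excess over the mirror image of that ball;
    there the kernel is at most [(x ord0 ord0 - l) `^ (- p)], which gives the last
    term. *)
Lemma antisym_trunc (eta : R) : w x <= 0 -> 0 <= eta ->
  (forall y, enorm (x - y) < e -> w x + w y <= eta) ->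
  \int[mu]_(y in D) F y <= \int[mu]_(y in halfsp `&` D) folded_kernel y
    + eta * (x ord0 ord0 - l) `^ (- p) * (2 * e) ^+ n.+1.
Proof.
move=> wx0 eta0 weta.
pose T := [set y : 'rV[R]_n.+1 | y ord0 ord0 = l].
have mT : measurable T.
  have := @measurable_coord_itv R n ord0 `[l, l].
  rewrite (_ : [set _ | _] = T)//; apply/seteqP.
  by split => y; rewrite /= in_itv/= -eq_le eq_sym => /eqP.
have DE : D = (halfsp `&` D) `|` (low `|` T).
  apply/seteqP; split => y.
    move=> Dy; rewrite /= /halfsp/low/T/=.
    by case: (ltgtP l (y ord0 ord0)) => //; [left|right; left|right; right].
  by case=> [[]//|h]; apply: lowD; case: h; rewrite /halfsp/low/T/=; lra.
have iT : mu.-integrable T (EFin \o F).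
  by apply: (integrableS _ _ _ iF) => //; rewrite -/D DE => y ?; right; right.
have -> : \int[mu]_(y in D) F y = \int[mu]_(y in halfsp `&` D) F y +
    (\int[mu]_(y in low) F y + \int[mu]_(y in T) F y).
  have mLT : measurable (low `|` T) by exact: measurableU.
  have i1 : mu.-integrable (halfsp `&` D `|` (low `|` T)) (EFin \o F) by rewrite -DE.
  have i2 : mu.-integrable (low `|` T) (EFin \o F).
    by apply: (integrableS _ _ _ i1) => //; exact: measurableU.
  have d1 : [disjoint halfsp `&` D & low `|` T].
    by apply/disj_setPRL => y h [h1 _]; move: h h1; rewrite /halfsp/low/T/= => -[]; lra.
  have d2 : [disjoint low & T] by apply/disj_setPRL => y; rewrite /low/T/=; lra.
  have := Rintegral_setU mHD mLT i1 d1; rewrite -DE => ->.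
  by rewrite (Rintegral_setU mlow mT i2 d2).
have T0 : \int[mu]_(y in T) F y <= 0.
  have := le_Rintegral mT iT (integrable0 mu T).
  rewrite Rintegral_cst// mul0r; apply => y Ty.
  by rewrite mulr_le0_ge0 ?ker_ge0// {2}/adiff (refl_fixed Ty) subrr subr0.
have -> : \int[mu]_(y in low) F y = \int[mu]_(y in halfsp) (F \o refl l) y.
  by rewrite (Rintegral_refl l mlow iFlow) low_refl.
have mHD' : measurable (halfsp `\` D) by apply: measurableD => //; exact: measurable_off_ball.
have iHF2 : mu.-integrable (halfsp `\` D) (EFin \o (F \o refl l)).
  by apply: (integrableS _ _ _ iF') => //; exact: subDsetl.
have -> : \int[mu]_(y in halfsp) (F \o refl l) y =
    \int[mu]_(y in halfsp `&` D) (F \o refl l) y +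
    \int[mu]_(y in halfsp `\` D) (F \o refl l) y.
  have d3 : [disjoint halfsp `&` D & halfsp `\` D] by apply/disj_setPRL => y [_ +] [].
  have E : halfsp `&` D `|` halfsp `\` D = halfsp by rewrite setUIDK.
  have i3 : mu.-integrable (halfsp `&` D `|` halfsp `\` D) (EFin \o (F \o refl l)).
    by rewrite E.
  by have := Rintegral_setU mHD mHD' i3 d3; rewrite E.
have -> : \int[mu]_(y in halfsp `&` D) folded_kernel y = \int[mu]_(y in halfsp `&` D) F y +
   \int[mu]_(y in halfsp `&` D) (F \o refl l) y.
  by rewrite -(RintegralD mHD iHF iHF'); apply: eq_Rintegral => y _; rewrite folded_kernelE.
suff : \int[mu]_(y in halfsp `\` D) (F \o refl l) y <=
    eta * (x ord0 ord0 - l) `^ (- p) * (2 * e) ^+ n.+1.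
  by move=> h; rewrite -!addrA 2!lerD2l -[leRHS]addr0; exact: lerD.
have sc : halfsp `\` D `<=` cube x e.
  move=> y [_]; rewrite /off_ball/= => /negP; rewrite -ltNge; exact: enorm_lt_cube.
have mc : (mu (halfsp `\` D) <= ((2 * e) ^+ n.+1)%:E)%E.
  by rewrite -(mu_cube x (ltW e0)) le_measure// inE//; exact: measurable_obox.
have fc : (mu (halfsp `\` D) < +oo)%E by apply: le_lt_trans mc _; rewrite ltry.
have fm : mu (halfsp `\` D) \is a fin_num by rewrite ge0_fin_numE.
pose C := eta * (x ord0 ord0 - l) `^ (- p).
have C0 : 0 <= C by rewrite mulr_ge0// powR_ge0.
have iC : mu.-integrable (halfsp `\` D) (EFin \o cst C).
  exact: integrable_cst_fin.
apply: (@le_trans _ _ (\int[mu]_(y in halfsp `\` D) (cst C) y)).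
  apply: le_Rintegral => // y [ly /negP]; rewrite /off_ball/= -ltNge => ye.
  have ly' : l < y ord0 ord0 := ly.
  have dp : 0 < x ord0 ord0 - l by rewrite subr_gt0.
  have k1 := ker_le p0 dp (enorm_refl_dist (ltW lx) (ltW ly')).
  have k0 := ker_ge0 p x (refl l y).
  have h := weta y ye.
  rewrite /F adiff_refl opprK /C.
  by apply: le_trans (ler_wpM2r k0 h) _; exact: ler_wpM2l.
rewrite Rintegral_cst// -/C ler_wpM2l//.
by rewrite -lee_fin fineK.
Qed.

End small.
End antisymmetric.

(** * The cusp of critical exponent *)

Section scaled_bound.
Context d (T : measurableType d) (R : realType).
Variable mu : {measure set T -> \bar R}.

Lemma ge0_integral_le_scale (D : set T) (f h : T -> R) (a M : R) :
  measurable D -> 0 <= a -> measurable_fun D f -> measurable_fun D h ->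
  (forall y, 0 <= f y) -> (forall y, 0 <= h y) -> (forall y, f y <= a * h y) ->
  (\int[mu]_(y in D) (h y)%:E <= M%:E)%E ->
  (\int[mu]_(y in D) (f y)%:E <= (a * M)%:E)%E.
Proof.
move=> mD a0 mf mh f0 h0 fh H; rewrite EFinM.
apply: le_trans (lee_wpmul2l _ H); last by rewrite lee_fin.
rewrite -ge0_integralZl//; last 2 first.
- exact/measurable_EFinP.
- by move=> y _; rewrite lee_fin.
apply: ge0_le_integral => //.
- by move=> y _; rewrite lee_fin.
- exact/measurable_EFinP.
- by apply: measurable_funeM; exact/measurable_EFinP.
- by move=> y _; rewrite -EFinM lee_fin.
Qed.

End scaled_bound.

Section annuli.
Context {R : realType} {n : nat}.
Local Notation mu := (lebesgue_rV n.+1).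
Implicit Types (x y : 'rV[R]_n.+1) (r : R).

Definition ann x (r r' : R) : set 'rV[R]_n.+1 :=
  off_ball x r `\` off_ball x r'.

Lemma annP x r r' y : ann x r r' y <-> r <= enorm (x - y) < r'.
Proof.
split=> [[h /negP]|/andP[h1 h2]]; first by rewrite /off_ball/= -ltNge => ->; rewrite andbT.
by split => //; apply/negP; rewrite -ltNge.
Qed.

Lemma measurable_ann x r r' : measurable (ann x r r').
Proof. by apply: measurableD; exact: measurable_off_ball. Qed.

Lemma ann_split x r r' r'' : r <= r' -> r' <= r'' ->
  ann x r r'' = ann x r r' `|` ann x r' r''.
Proof.
move=> h1 h2; apply/seteqP; split => y.
  move=> /annP/andP[a b]; have [c|c] := ltP (enorm (x - y)) r'.
    by left; apply/annP; rewrite a c.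
  by right; apply/annP; rewrite c b.
by case=> /annP/andP[a b]; apply/annP; apply/andP; split => //;
  [exact: lt_le_trans b h2|exact: le_trans h1 a].
Qed.

Lemma ann_disj x r r' r'' : [disjoint ann x r r' & ann x r' r''].
Proof. by apply/disj_setPRL => y /annP/andP[a _] /annP/andP[_]; rewrite ltNge a. Qed.

Lemma mu_ann x r r' : 0 <= r' -> (mu (ann x r r') <= ((2 * r') ^+ n.+1)%:E)%E.
Proof.
move=> r0; rewrite -(mu_cube x r0) le_measure// ?inE.
- exact: measurable_ann.
- exact: measurable_obox.
- by move=> y /annP/andP[_]; exact: enorm_lt_cube.
Qed.

Variables (x : 'rV[R]_n.+1) (G : 'rV[R]_n.+1 -> R).
Hypotheses (mG : measurable_fun [set: 'rV[R]_n.+1] G) (G0 : forall y, 0 <= G y).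

Let mGE (D : set 'rV[R]_n.+1) : measurable_fun D (EFin \o G).
Proof. by apply/measurable_EFinP; exact: measurable_funTS. Qed.

Lemma ann_integral_split r r' r'' : r <= r' -> r' <= r'' ->
  (\int[mu]_(y in ann x r r'') (G y)%:E = \int[mu]_(y in ann x r r') (G y)%:E +
   \int[mu]_(y in ann x r' r'') (G y)%:E)%E.
Proof.
move=> h1 h2; rewrite (ann_split x h1 h2) ge0_integral_setU//.
- exact: measurable_ann.
- exact: measurable_ann.
- by move=> y _; rewrite lee_fin.
- exact: ann_disj.
Qed.

(** Bounds on dyadic annuli telescope along a potential [phi]. *)
Lemma dyadic_integral_le (phi : R -> R) :
  (forall r, 0 < r -> (\int[mu]_(y in ann x r (2 * r)) (G y)%:E <= (phi (2 * r) - phi r)%:E)%E) ->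
  forall r k, 0 < r ->
  (\int[mu]_(y in ann x r (2 ^+ k * r)) (G y)%:E <= (phi (2 ^+ k * r) - phi r)%:E)%E.
Proof.
move=> h r k r0; elim: k => [|k IH].
  rewrite expr0 mul1r subrr (_ : ann x r r = set0) ?integral_set0//.
  by rewrite -subset0 => y /annP/andP[a]; rewrite ltNge a.
have p1 : 1 <= 2 ^+ k :> R by rewrite exprn_ege1// ler1n.
rewrite (@ann_integral_split _ (2 ^+ k * r)); last 2 first.
- by rewrite ler_peMl// ltW.
- by rewrite exprS -mulrA ler_peMl// ?ler1n// mulr_ge0// ?ltW// exprn_gt0.
have r1 : 0 < 2 ^+ k * r by rewrite mulr_gt0// exprn_gt0.
rewrite exprS -mulrA; apply: le_trans (leeD IH (h _ r1)) _.
by rewrite -EFinD lee_fin addrC addrA subrK.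
Qed.

Lemma dyadic_integral_ge (c : R) :
  (forall r, 0 < r -> (c%:E <= \int[mu]_(y in ann x r (2 * r)) (G y)%:E)%E) ->
  forall r k, 0 < r ->
  ((k%:R * c)%:E <= \int[mu]_(y in ann x r (2 ^+ k * r)) (G y)%:E)%E.
Proof.
move=> h r k r0; elim: k => [|k IH].
  by rewrite mul0r integral_ge0// => y _; rewrite lee_fin.
have p1 : 1 <= 2 ^+ k :> R by rewrite exprn_ege1// ler1n.
rewrite (@ann_integral_split _ (2 ^+ k * r)); last 2 first.
- by rewrite ler_peMl// ltW.
- by rewrite exprS -mulrA ler_peMl// ?ler1n// mulr_ge0// ?ltW// exprn_gt0.
have r1 : 0 < 2 ^+ k * r by rewrite mulr_gt0// exprn_gt0.
have := leeD IH (h _ r1); rewrite -EFinD mulrA -exprS; apply: le_trans.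
by rewrite lee_fin -natr1 mulrDl mul1r.
Qed.

Lemma ann_integral_bound r r' (M : R) : 0 <= r' -> 0 <= M ->
  (forall y, ann x r r' y -> G y <= M) ->
  (\int[mu]_(y in ann x r r') (G y)%:E <= (M * (2 * r') ^+ n.+1)%:E)%E.
Proof.
move=> r0 M0 GM; apply: (@le_trans _ _ (\int[mu]_(y in ann x r r') (cst M%:E) y)%E).
  apply: ge0_le_integral => //; first exact: measurable_ann.
  - by move=> y _; rewrite lee_fin.
rewrite integral_cst; last exact: measurable_ann.
by rewrite EFinM lee_pmul// ?lee_fin//; exact: mu_ann.
Qed.

End annuli.

Section spike_integrals.
Context {R : realType} {n : nat}.
Local Notation mu := (lebesgue_rV n.+1).
Variables (b : R).
Hypothesis b02 : 0 < b < 2.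
Local Notation p := (n.+1%:R + b).
Implicit Types (x y : 'rV[R]_n.+1) (r : R).

Let b0 : 0 < b. Proof. by case/andP: b02. Qed.
Let p0 : 0 < p. Proof. by rewrite addr_gt0// ltr0n. Qed.

Let powRp r : 0 < r -> r `^ (- p) * r ^+ n.+1 = r `^ (- b).
Proof.
move=> r0; rewrite -powR_mulrn ?(ltW r0)// -powRD; first by congr (_ `^ _); ring.
by rewrite (gt_eqF r0) implybT.
Qed.

(** Chosen so that [fun r => - (outer_const * r `^ (- b))] grows from [r] to [2 * r]
    by [4 ^+ n.+1 * r `^ (- b)], the largest value of the kernel on the annulus times
    the volume of a cube around it; [inner_const] plays the same role for the kernel
    multiplied by the squared distance. *)
Definition outer_const : R := 4 ^+ n.+1 / (1 - 2 `^ (- b)).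
Definition inner_const : R := 4 ^+ n.+2 / (2 `^ (2 - b) - 1).

Lemma two_powR_lt1 : 2 `^ (- b) < 1 :> R.
Proof.
rewrite powRN invf_lt1 ?powR_gt0//.
have := @gt0_ltr_powR R b b0 1 2; rewrite powR1; apply; rewrite ?nnegrE//.
by rewrite ltr1n.
Qed.

Lemma two_powR_gt1 : 1 < 2 `^ (2 - b) :> R.
Proof.
have h : 0 < 2 - b by rewrite subr_gt0; case/andP: b02.
have := @gt0_ltr_powR R (2 - b) h 1 2; rewrite powR1; apply; rewrite ?nnegrE//.
by rewrite ltr1n.
Qed.

Lemma outer_integral x r k : 0 < r ->
  (\int[mu]_(y in ann x r (2 ^+ k * r)) (ker p x y)%:E <= (outer_const * r `^ (- b))%:E)%E.
Proof.
move=> r0; have q1 := two_powR_lt1.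
have C0 : 0 <= outer_const by rewrite divr_ge0 ?exprn_ge0// subr_ge0 ltW.
have := @dyadic_integral_le R n x (ker p x) (measurable_ker _ _) (ker_ge0 p x)
  (fun r => - (outer_const * r `^ (- b))) _ r k r0.
move=> /(_ _)/le_trans; apply; last first.
  by rewrite lee_fin opprK gerDr oppr_le0 mulr_ge0// powR_ge0.
move=> {}r {}r0; rewrite opprK powRM ?(ltW r0)//.
rewrite (_ : - _ + _ = r `^ (- p) * (2 * (2 * r)) ^+ n.+1).
  apply: ann_integral_bound; [exact: measurable_ker|exact: ker_ge0|lra|exact: powR_ge0|].
  by move=> y /annP/andP[ry _]; exact: ker_le.
rewrite (_ : 2 * (2 * r) = 4 * r); last by ring.
rewrite [in RHS]exprMn [RHS]mulrCA powRp// /outer_const; field.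
by rewrite subr_eq0 gt_eqF.
Qed.

Lemma inner_integral x r k : 0 < r ->
  (\int[mu]_(y in ann x r (2 ^+ k * r)) (enorm (x - y) ^+ 2 * ker p x y)%:E
    <= (inner_const * (2 ^+ k * r) `^ (2 - b))%:E)%E.
Proof.
move=> r0; have q1 := two_powR_gt1.
have C0 : 0 <= inner_const by rewrite divr_ge0 ?exprn_ge0// subr_ge0 ltW.
have mG : measurable_fun [set: 'rV[R]_n.+1] (fun y => enorm (x - y) ^+ 2 * ker p x y).
  apply: measurable_funM; last exact: measurable_ker.
  by apply: measurable_funX; exact: measurable_enormB.
have G0 y : 0 <= enorm (x - y) ^+ 2 * ker p x y by rewrite mulr_ge0 ?sqr_ge0 ?ker_ge0.
have := @dyadic_integral_le R n x _ mG G0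
  (fun r => inner_const * r `^ (2 - b)) _ r k r0.
move=> /(_ _)/le_trans; apply; last first.
  by rewrite lee_fin gerDl oppr_le0 mulr_ge0// powR_ge0.
move=> {}r {}r0; rewrite powRM ?(ltW r0)//.
rewrite (_ : _ - _ = ((2 * r) ^+ 2 * r `^ (- p)) * (2 * (2 * r)) ^+ n.+1).
  apply: ann_integral_bound; [exact: mG|exact: G0|lra| |].
    by rewrite mulr_ge0 ?powR_ge0 ?sqr_ge0.
  move=> y /annP/andP[ry ry2]; rewrite ler_pM ?sqr_ge0 ?ker_ge0//; last exact: ker_le.
  by rewrite lerXn2r ?nnegrE ?enorm_ge0 ?ltW//; lra.
rewrite (_ : 2 * (2 * r) = 4 * r); last by ring.
rewrite [in RHS]exprMn [(4 * r) ^+ _]exprMn.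
transitivity (2 ^+ 2 * 4 ^+ n.+1 * (r ^+ 2 * (r `^ (- p) * r ^+ n.+1))); last first.
  by move: (r `^ _) (4 ^+ _) (r ^+ _) => A B C; ring.
rewrite powRp// -[r ^+ 2]powR_mulrn ?(ltW r0)// -powRD; last by rewrite (gt_eqF r0) implybT.
rewrite /inner_const [4 ^+ n.+2]exprS; field.
by rewrite subr_eq0 gt_eqF.
Qed.

(** By the inequality of arithmetic and geometric means the sum of the two shifted
    powers is at least [2 * `|t ^+ 2 - h ^+ 2| `^ (b / 2)]. For [`|h| < `|t|] this is
    [2 * `|t| `^ b * (1 - z) `^ (b / 2)] with [z = h ^+ 2 / t ^+ 2], and the outer
    exponent can be dropped because [b / 2 <= 1] and [1 - z] lies between 0 and 1. *)
Lemma second_difference_le (t h : R) : t != 0 ->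
  2 * `|t| `^ b - `|t + h| `^ b - `|t - h| `^ b <=
  2 * (`|t| `^ b * Num.min 1 (h ^+ 2 / t ^+ 2)).
Proof.
move=> t0; set A := `|t + h| `^ b; set B := `|t - h| `^ b.
have A0 : 0 <= A := powR_ge0 _ _.
have B0 : 0 <= B := powR_ge0 _ _.
have T0 : 0 <= `|t| `^ b := powR_ge0 _ _.
have t20 : 0 < t ^+ 2 by rewrite exprn_even_gt0.
have [_|h1] := leP 1 (h ^+ 2 / t ^+ 2).
  by rewrite mulr1; lra.
have hge0 : 0 <= h ^+ 2 / t ^+ 2 by rewrite divr_ge0 ?sqr_ge0.
set z := h ^+ 2 / t ^+ 2 in h1 hge0 *.
have ABge : (2 * (`|t| `^ b * (1 - z))) ^+ 2 <= 4 * (A * B).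
  have -> : A * B = (`|t| `^ b * (1 - z) `^ (b / 2)) ^+ 2.
    rewrite exprMn -!powR_mulrn ?powR_ge0// -!powRrM.
    rewrite (_ : b * 2 = 2 * b); last by ring.
    rewrite (_ : b / 2 * 2 = b); last by field.
    rewrite powRrM powR_mulrn ?normr_ge0// -[RHS]powRM ?sqr_ge0 ?subr_ge0 ?(ltW h1)//.
    rewrite /A /B -[LHS]powRM ?normr_ge0// -normrM; congr (_ `^ b).
    have -> : (t + h) * (t - h) = t ^+ 2 * (1 - z) by rewrite /z; field.
    by rewrite normrM normrX [`|1 - z|]ger0_norm// subr_ge0 ltW.
  rewrite exprMn (_ : 2 ^+ 2 = 4); last by ring.
  rewrite ler_pM2l// !exprMn ler_wpM2l ?sqr_ge0// lerXn2r ?nnegrE ?powR_ge0 ?subr_ge0 ?(ltW h1)//.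
  by apply: ger1_powR; [rewrite subr_gt0 h1/= lerBlDr lerDl|case/andP: b02; lra].
have : 2 * (`|t| `^ b * (1 - z)) <= A + B.
  rewrite -ler_sqr ?nnegrE ?addr_ge0 ?mulr_ge0 ?subr_ge0 ?(ltW h1)//.
  apply: le_trans ABge _.
  by have := sqr_ge0 (A - B); rewrite sqrrB sqrrD; lra.
by rewrite mulrBr mulr1; lra.
Qed.

(** A cusp along the hyperplane where the first coordinate equals [c], with the
    critical exponent [b] of the kernel [ker (n.+1%:R + b)]: it is just sharp enough
    for the truncated integrals at a point of the cusp to diverge, and just flat
    enough for them to be bounded on one side, uniformly, at all other points. *)
Definition spike (c : R) x y : R := `|y ord0 ord0 - c| `^ b - `|x ord0 ord0 - c| `^ b.

Lemma measurable_spike c x : measurable_fun [set: 'rV[R]_n.+1] (spike c x).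
Proof.
apply: measurable_funB => //.
apply: (@measurableT_comp _ _ _ _ _ _ (fun t : R => `|t - c| `^ b) _
  (fun y : 'rV[R]_n.+1 => y ord0 ord0 : measurableTypeR R)).
  apply: (@measurableT_comp _ _ _ _ _ _ (fun t : R => t `^ b)) => //.
  by apply: measurableT_comp => //; exact: measurable_funB.
exact: measurable_coord.
Qed.

Lemma spike_bound c x y (s : R) : 0 <= s -> enorm (x - y) <= s ->
  `|spike c x y| <= (`|x ord0 ord0 - c| + s) `^ b.
Proof.
move=> s0 xys.
have h : `|x ord0 ord0 - y ord0 ord0| <= s.
  by have := coord_le_enorm (x - y) ord0; rewrite !mxE => /le_trans; apply.
have a0 : 0 <= `|x ord0 ord0 - c| + s by rewrite addr_ge0.
have h1 : `|y ord0 ord0 - c| `^ b <= (`|x ord0 ord0 - c| + s) `^ b.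
  rewrite ge0_ler_powR ?nnegrE ?(ltW b0)//.
  rewrite (_ : y ord0 ord0 - c = (x ord0 ord0 - c) - (x ord0 ord0 - y ord0 ord0)); last by ring.
  by apply: le_trans (ler_normB _ _) _; rewrite lerD2l.
have h2 : `|x ord0 ord0 - c| `^ b <= (`|x ord0 ord0 - c| + s) `^ b.
  by rewrite ge0_ler_powR ?nnegrE ?(ltW b0)// lerDl.
rewrite /spike; move: h1 h2 (powR_ge0 `|y ord0 ord0 - c| b) (powR_ge0 `|x ord0 ord0 - c| b).
move: (_ `^ _) (_ `^ _) (_ `^ _) => A B C; rewrite ler_norml; lra.
Qed.

Lemma integrable_spike c x (e s : R) : 0 < e -> 0 < s ->
  mu.-integrable (ann x e s) (EFin \o (fun y => - spike c x y * ker p x y)).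
Proof.
move=> e0 s0; apply: (@integrable_bounded_fin _ _ _ _ _ _
  ((`|x ord0 ord0 - c| + s) `^ b * e `^ (- p))).
- exact: measurable_ann.
- by apply: le_lt_trans (mu_ann _ _ (ltW s0)) _; rewrite ltry.
- apply: measurable_funTS; apply: measurable_funM; last exact: measurable_ker.
  by apply: measurableT_comp => //; exact: measurable_spike.
- move=> y /annP/andP[ey ys]; rewrite normrM normrN ler_pM//.
    by apply: spike_bound; exact: ltW.
  by rewrite ger0_norm ?ker_ge0//; exact: ker_le.
Qed.

Lemma ann_refl x (e s : R) : refl (x ord0 ord0) @^-1` ann x e s = ann x e s.
Proof.
have rx : refl (x ord0 ord0) x = x by exact: refl_fixed.
have E y : enorm (x - refl (x ord0 ord0) y) = enorm (x - y) by rewrite -enorm_reflC rx.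
by apply/seteqP; split => y; rewrite /ann /off_ball /= E.
Qed.

(** Averaging over the reflection that fixes [x] turns first differences of the
    cusp into second differences. *)
Lemma spike_symm c x (e s : R) : 0 < e -> 0 < s ->
  2 * \int[mu]_(y in ann x e s) (- spike c x y * ker p x y) =
  \int[mu]_(y in ann x e s)
    ((- spike c x y - spike c x (refl (x ord0 ord0) y)) * ker p x y).
Proof.
move=> e0 s0; have i1 := integrable_spike c x e0 s0.
have mA := measurable_ann x e s.
have i2 := integrable_refl (x ord0 ord0) mA i1; rewrite ann_refl in i2.
have rx : refl (x ord0 ord0) x = x by exact: refl_fixed.
have kr y : ker p x (refl (x ord0 ord0) y) = ker p x y by rewrite -ker_reflC rx.
set f := fun y => - spike c x y * ker p x y in i1 i2 *.
have E : \int[mu]_(y in ann x e s) f y = \int[mu]_(y in ann x e s) (f \o refl (x ord0 ord0)) y.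
  exact: Rintegral_refl_stable mA (ann_refl x e s) i1.
rewrite mulr_natl mulr2n {2}E -(RintegralD mA i1 i2); apply: eq_Rintegral => y _ /=.
by rewrite /f kr; move: (ker _ _ _) (spike _ _ _) (spike _ _ _) => A B C; ring.
Qed.

Lemma archi_pow2 (r s : R) : 0 < r -> exists k : nat, s <= 2 ^+ k * r.
Proof.
move=> r0; pose k := (Num.truncn `|s / r|).+1; exists k.
have h : `|s / r| < k%:R by exact: truncnS_gt.
have h2 : (k%:R : R) <= 2 ^+ k by rewrite -natrX ler_nat ltnW// ltn_expl.
rewrite -ler_pdivrMr//; apply: le_trans (ler_norm _) _.
exact: le_trans (ltW h) h2.
Qed.

(** Let [tau] be the distance from [x] to the cusp. Inside the ball of radius [tau]
    the quadratic bound on second differences is integrable, outside of it the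
    bound by [2 * tau `^ b] is; since [b] is critical, the powers of [tau] cancel and
    the constant does not depend on the distance to the cusp. *)
Lemma spike_integral_le c x (e s : R) : 0 < e -> 0 < s -> x ord0 ord0 != c ->
  \int[mu]_(y in ann x e s) (- spike c x y * ker p x y) <= outer_const + inner_const.
Proof.
move=> e0 s0 xc.
set t := x ord0 ord0 - c.
have t0 : t != 0 by rewrite subr_eq0.
pose tau := `|t|; have tau0 : 0 < tau by rewrite normr_gt0.
have tau2 : tau ^+ 2 = t ^+ 2 by rewrite -normrX ger0_norm ?sqr_ge0.
have mA := measurable_ann x e s.
pose G y := tau `^ b * Num.min 1 (enorm (x - y) ^+ 2 / tau ^+ 2) * ker p x y.
have G0 y : 0 <= G y.
  by rewrite !mulr_ge0 ?powR_ge0 ?ker_ge0// le_min ler01/= divr_ge0 ?sqr_ge0.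
have mG : measurable_fun [set: 'rV[R]_n.+1] G.
  apply: measurable_funM; last exact: measurable_ker.
  apply: measurable_funM => //; apply: measurable_minr => //.
  apply: measurable_funM => //; apply: measurable_funX; exact: measurable_enormB.
have fA : (mu (ann x e s) < +oo)%E.
  by apply: le_lt_trans (mu_ann _ _ (ltW s0)) _; rewrite ltry.
have iG : mu.-integrable (ann x e s) (EFin \o G).
  apply: (@integrable_bounded_fin _ _ _ _ _ _ (tau `^ b * e `^ (- p))) => //.
    exact: measurable_funTS.
  move=> y /annP/andP[ey ys]; rewrite ger0_norm// /G ler_pM ?ker_ge0//; last exact: ker_le.
    by rewrite mulr_ge0 ?powR_ge0// le_min ler01/= divr_ge0 ?sqr_ge0.
  by rewrite ler_piMr ?powR_ge0// ge_min lexx.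
have i1 := integrable_spike c x e0 s0.
have i2 := integrable_refl (x ord0 ord0) mA i1; rewrite ann_refl in i2.
have rx : refl (x ord0 ord0) x = x by exact: refl_fixed.
have kr y : ker p x (refl (x ord0 ord0) y) = ker p x y by rewrite -ker_reflC rx.
have step1 : \int[mu]_(y in ann x e s) (- spike c x y * ker p x y) <=
    \int[mu]_(y in ann x e s) G y.
  have iS : mu.-integrable (ann x e s)
      (EFin \o (fun y => (- spike c x y - spike c x (refl (x ord0 ord0) y)) * ker p x y)).
    have := integrableD mA i1 i2; apply: eq_integrable => // y _ /=.
    by rewrite kr -EFinD; congr EFin; move: (ker _ _ _) (spike _ _ _) (spike _ _ _) => A B C; ring.
  have iG2 : mu.-integrable (ann x e s) (EFin \o (fun y => 2 * G y)).
    by have := integrableZl mA 2 iG; apply: eq_integrable => // y _.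
  have SG y : (- spike c x y - spike c x (refl (x ord0 ord0) y)) * ker p x y <= 2 * G y.
    rewrite /G mulrA ler_wpM2r ?ker_ge0//.
    set h := y ord0 ord0 - x ord0 ord0.
    have E : - spike c x y - spike c x (refl (x ord0 ord0) y) =
        2 * `|t| `^ b - `|t + h| `^ b - `|t - h| `^ b.
      rewrite /spike refl_0 -/t.
      rewrite (_ : y ord0 ord0 - c = t + h); last by rewrite /t /h; ring.
      rewrite (_ : 2 * x ord0 ord0 - y ord0 ord0 - c = t - h); last by rewrite /t /h; ring.
      by move: (_ `^ _) (_ `^ _) (_ `^ _) => A B C; ring.
    rewrite E; apply: le_trans (second_difference_le h t0) _.
    rewrite ler_pM2l// ler_wpM2l ?powR_ge0//.
    rewrite le_min !ge_min lexx/=; apply/orP; right.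
    rewrite tau2 ler_wpM2r ?invr_ge0 ?sqr_ge0//.
    rewrite -[leLHS]ger0_norm ?sqr_ge0// normrX lerXn2r ?nnegrE ?enorm_ge0//.
    by have := coord_le_enorm (x - y) ord0; rewrite !mxE distrC.
  have L := le_Rintegral mA iS iG2 (fun y _ => SG y).
  have E1 := spike_symm c x e0 s0; have E2 := RintegralZl 2 mA iG.
  by rewrite -(ler_pM2l (ltr0Sn R 1)) -E2 E1; exact: L.
apply: le_trans step1 _.
have [k1 hk1] := archi_pow2 (tau / e * e) e0.
have [k2 hk2] := archi_pow2 s tau0.
pose r0 := tau / 2 ^+ k1.
have pk1 : 0 < 2 ^+ k1 :> R by rewrite exprn_gt0.
have r00 : 0 < r0 by rewrite divr_gt0.
have r0t : 2 ^+ k1 * r0 = tau by rewrite /r0 mulrC divfK// gt_eqF.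
have r0e : r0 <= e.
  by rewrite /r0 ler_pdivrMr// mulrC; apply: le_trans hk1; rewrite divfK// gt_eqF.
apply: ge0_Rintegral_le => [y _|]; first exact: G0.
have sub : ann x e s `<=` ann x r0 (2 ^+ k2 * tau).
  by move=> y /annP/andP[h1 h2]; apply/annP; rewrite (le_trans r0e)//=; exact: lt_le_trans h2 hk2.
apply: (@le_trans _ _ (\int[mu]_(y in ann x r0 (2 ^+ k2 * tau)) (G y)%:E)%E).
  apply: ge0_subset_integral => //; first exact: measurable_ann.
    by apply/measurable_EFinP; exact: measurable_funTS.
  by move=> y _; rewrite lee_fin.
rewrite (ann_integral_split (r' := tau) x mG G0); last 2 first.
- by rewrite -r0t ler_peMl ?exprn_ege1 ?ler1n// ltW.
- by rewrite ler_peMl ?exprn_ege1 ?ler1n// ltW.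
have tb : tau `^ b * tau `^ (- b) = 1.
  by rewrite powRN divff// gt_eqF// powR_gt0.
rewrite [outer_const + inner_const]addrC EFinD; apply: leeD.
- have H := inner_integral x k1 r00; rewrite r0t in H.
  have h2 : tau `^ b / tau ^+ 2 * (inner_const * tau `^ (2 - b)) = inner_const.
    rewrite -powR_mulrn ?(ltW tau0)// -powRB; last by rewrite (gt_eqF tau0) implybT.
    rewrite mulrCA -powRD; last by rewrite (gt_eqF tau0) implybT.
    by rewrite addrA subrK subrr powRr0 mulr1.
  have c0 : 0 <= tau `^ b / tau ^+ 2 by rewrite divr_ge0 ?powR_ge0 ?sqr_ge0.
  have mH : measurable_fun [set: 'rV[R]_n.+1] (fun y => enorm (x - y) ^+ 2 * ker p x y).
    apply: measurable_funM; last exact: measurable_ker.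
    by apply: measurable_funX; exact: measurable_enormB.
  rewrite -[X in (_ <= X%:E)%E]h2; apply: ge0_integral_le_scale H => //.
  + exact: measurable_ann.
  + exact: measurable_funTS.
  + exact: measurable_funTS.
  + by move=> y; rewrite mulr_ge0 ?sqr_ge0 ?ker_ge0.
  + move=> y; rewrite /G mulrA ler_wpM2r ?ker_ge0//.
    by rewrite -mulrA ler_wpM2l ?powR_ge0// ge_min mulrC lexx orbT.
- have H := outer_integral x k2 tau0.
  have h2 : tau `^ b * (outer_const * tau `^ (- b)) = outer_const by rewrite mulrCA tb mulr1.
  rewrite -[X in (_ <= X%:E)%E]h2; apply: ge0_integral_le_scale H => //.
  + exact: measurable_ann.
  + exact: powR_ge0.
  + exact: measurable_funTS.
  + by apply: measurable_funTS; exact: measurable_ker.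
  + by move=> y; exact: ker_ge0.
  + move=> y; rewrite /G ler_wpM2r ?ker_ge0//.
    by rewrite ler_piMr ?powR_ge0// ge_min lexx.
Qed.

Definition annulus_const : R := (2 `^ (- p)) * (2^-1 * (2 / n.+1%:R) ^+ n).

Lemma annulus_const_gt0 : 0 < annulus_const.
Proof. by rewrite !mulr_gt0 ?powR_gt0 ?invr_gt0// exprn_gt0// divr_gt0. Qed.

(** The box below has sides proportional to [r]; on it both factors are comparable
    to their value at scale [r], and the scale invariance at the critical exponent
    leaves a constant independent of [r]. *)
Lemma spike_annulus_ge x r : 0 < r ->
  (annulus_const%:E <= \int[mu]_(y in ann x r (2 * r))
     (`|y ord0 ord0 - x ord0 ord0| `^ b * ker p x y)%:E)%E.
Proof.
move=> r0.
(* sides r / n.+1 in the last n directions: their squares add up to at most r ^ 2 *)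
pose d : R := r / n.+1%:R.
have d0 : 0 < d by rewrite divr_gt0.
pose a1 : 'rV[R]_n.+1 := \row_i (x ord0 i + (if i == ord0 then r else - d)).
pose a2 : 'rV[R]_n.+1 := \row_i (x ord0 i + (if i == ord0 then 3 / 2 * r else d)).
have bP y : obox a1 a2 y -> r < y ord0 ord0 - x ord0 ord0 < 3 / 2 * r /\
   forall i, i != ord0 -> `|x ord0 i - y ord0 i| < d.
  move=> h; split; first by have := h ord0; rewrite !mxE eqxx; lra.
  by move=> i i0; have := h i; rewrite !mxE (negbTE i0) ltr_norml; lra.
have sub : obox a1 a2 `<=` ann x r (2 * r).
  move=> y /bP[/andP[h1 h2] h3]; apply/annP; apply/andP; split.
    apply: le_trans (coord_le_enorm _ ord0); rewrite !mxE distrC.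
    by apply: le_trans (ler_norm _); exact: ltW.
  rewrite -ltr_sqr ?nnegrE ?enorm_ge0//; last by lra.
  rewrite enorm_sqr big_ord_recl.
  have e1 : (x - y) ord0 ord0 ^+ 2 < (3 / 2 * r) ^+ 2.
    rewrite !mxE -sqrrN opprB ltr_pXn2r ?nnegrE//; last by lra.
    by apply: le_trans (ltW h1); exact: ltW.
  have e2 : \sum_(i < n) (x - y) ord0 (lift ord0 i) ^+ 2 <= r ^+ 2.
    apply: (@le_trans _ _ (\sum_(i < n) d ^+ 2)).
      apply: ler_sum => i _; rewrite -[leLHS]ger0_norm ?sqr_ge0// normrX.
      rewrite lerXn2r ?nnegrE ?(ltW d0)//.
      by have := h3 (lift ord0 i); rewrite !mxE eq_sym (negbTE (neq_lift _ _)) => /(_ isT)/ltW.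
    rewrite sumr_const card_ord -[leLHS]mulr_natl /d exprMn mulrCA ler_piMr ?sqr_ge0//.
    rewrite exprVn ler_pdivrMr ?exprn_gt0// mul1r -natrX ler_nat.
    by rewrite (leq_trans (leqnSn n))// -[X in (X <= _)%N]expn1 leq_pexp2l.
  have : r ^+ 2 > 0 by rewrite exprn_gt0.
  rewrite (_ : (3 / 2 * r) ^+ 2 = 9 / 4 * r ^+ 2) in e1; last by field.
  rewrite (_ : (2 * r) ^+ 2 = 4 * r ^+ 2); last by ring.
  move: e1 e2; move: (\sum_(i < n) _) ((x - y) ord0 ord0 ^+ 2) (r ^+ 2) => A B C; lra.
have mb : mu (obox a1 a2) = (2^-1 * r * (2 * d) ^+ n)%:E.
  rewrite mu_obox; last first.
    by move=> i; rewrite !mxE; case: (i == ord0); move: r0 d0; lra.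
  congr EFin; rewrite big_ord_recl !mxE eqxx; congr (_ * _); first by field.
  rewrite (eq_bigr (fun=> 2 * d)); first by rewrite prodr_const card_ord.
  by move=> i _; rewrite !mxE eq_sym (negbTE (neq_lift _ _)); ring.
have mG : measurable_fun [set: 'rV[R]_n.+1] (fun y => `|y ord0 ord0 - x ord0 ord0| `^ b * ker p x y).
  have h := measurable_spike (x ord0 ord0) x.
  apply: measurable_funM; last exact: measurable_ker.
  rewrite (_ : (fun _ => _) = spike (x ord0 ord0) x)//; apply/funext => y.
  by rewrite /spike subrr normr0 powR0 ?subr0// gt_eqF.
apply: (@le_trans _ _ (\int[mu]_(y in obox a1 a2) (cst (r `^ b * (2 * r) `^ (- p))%:E) y)%E).
  rewrite integral_cst; last exact: measurable_obox.
  rewrite [X in (_ <= _ * X)%E]mb -EFinM lee_fin le_eqVlt; apply/orP; left; apply/eqP.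
  rewrite /annulus_const /d powRM ?(ltW r0)//.
  transitivity (r `^ b * (r `^ (- p) * r ^+ n.+1) * (2 `^ (- p) * (2^-1 * (2 / n.+1%:R) ^+ n))).
    rewrite powRp// -powRD; last by rewrite (gt_eqF r0) implybT.
    by rewrite subrr powRr0 mul1r.
  have -> : (2 * (r / n.+1%:R)) ^+ n = (2 / n.+1%:R) ^+ n * r ^+ n.
    by rewrite -exprMn; congr (_ ^+ n); ring.
  rewrite exprS; move: (r `^ b) (2 `^ _) (r `^ _) (r ^+ n) (_ ^+ n) => A B C D E; ring.
apply: (@le_trans _ _ (\int[mu]_(y in obox a1 a2)
    (`|y ord0 ord0 - x ord0 ord0| `^ b * ker p x y)%:E)%E); last first.
  apply: ge0_subset_integral => //; [exact: measurable_ann| |].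
    by apply/measurable_EFinP; exact: measurable_funTS.
  by move=> y _; rewrite lee_fin mulr_ge0 ?powR_ge0 ?ker_ge0.
apply: ge0_le_integral; first exact: measurable_obox.
- by move=> y _; rewrite lee_fin mulr_ge0 ?powR_ge0.
- exact: measurable_cst.
- by apply/measurable_EFinP; exact: measurable_funTS.
move=> y yb; have [/andP[h1 h2] _] := bP _ yb.
rewrite lee_fin ler_pM ?powR_ge0//.
  rewrite ge0_ler_powR ?nnegrE ?(ltW b0) ?(ltW r0)//.
  by apply: le_trans (ler_norm _); exact: ltW.
have /annP/andP[k1 k2] := sub _ yb.
by apply: ker_ge => //; [exact: lt_le_trans r0 k1|exact: ltW].
Qed.

(** Each dyadic annulus contributes at least the same amount, so the integral
    diverges logarithmically at a point of the cusp. *)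
Lemma spike_integral_diverges c x (s : R) k : 0 < s -> x ord0 ord0 = c ->
  \int[mu]_(y in ann x (s / 2 ^+ k) s) (- spike c x y * ker p x y) <= - (k%:R * annulus_const).
Proof.
move=> s0 xc.
pose G y := `|y ord0 ord0 - x ord0 ord0| `^ b * ker p x y.
have spE y : spike c x y = `|y ord0 ord0 - x ord0 ord0| `^ b.
  by rewrite /spike xc subrr normr0 powR0 ?subr0// gt_eqF.
have mG : measurable_fun [set: 'rV[R]_n.+1] G.
  apply: measurable_funM; last exact: measurable_ker.
  rewrite (_ : (fun _ => _) = spike c x); first exact: measurable_spike.
  by apply/funext => y; rewrite spE.
have G0 y : 0 <= G y by rewrite mulr_ge0 ?powR_ge0 ?ker_ge0.
have pk : 0 < 2 ^+ k :> R by rewrite exprn_gt0.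
have r0 : 0 < s / 2 ^+ k by rewrite divr_gt0.
have mA := measurable_ann x (s / 2 ^+ k) s.
have i1 := integrable_spike c x r0 s0.
have iG : mu.-integrable (ann x (s / 2 ^+ k) s) (EFin \o G).
  have := integrableN i1; apply: eq_integrable => // y _ /=.
  by rewrite /G spE mulNr opprK.
have H := dyadic_integral_ge mG G0 (@spike_annulus_ge x) k r0.
rewrite (_ : 2 ^+ k * (s / 2 ^+ k) = s) in H; last by rewrite mulrC divfK// gt_eqF.
have H2 := Rintegral_ge mA iG H.
have E := RintegralZl (-1) mA iG.
have -> : \int[mu]_(y in ann x (s / 2 ^+ k) s) (- spike c x y * ker p x y) =
  -1 * \int[mu]_(y in ann x (s / 2 ^+ k) s) G y.
  by rewrite -E; apply: eq_Rintegral => y _; rewrite /G spE mulN1r mulNr.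
by rewrite mulN1r lerN2.
Qed.

End spike_integrals.

(** * The nonlocal inequality at a perturbed minimum *)

Section restriction.
Context d (T : measurableType d) (R : realType).
Variable mu : {measure set T -> \bar R}.

Lemma integrable_patch (E S : set T) (f : T -> R) : measurable E -> measurable S ->
  S `<=` E -> mu.-integrable S (EFin \o f) -> mu.-integrable E (EFin \o (f \_ S)).
Proof.
move=> mE mS SE iS; rewrite -restrict_EFin; apply/integrable_restrict => //.
by rewrite setIidr.
Qed.

Lemma Rintegral_patch (E S : set T) (f : T -> R) : S `<=` E ->
  \int[mu]_(y in E) (f \_ S) y = \int[mu]_(y in S) f y.
Proof. by move=> SE; rewrite -Rintegral_mkcondr setIidr. Qed.

Lemma integrable_addR (E : set T) (f g : T -> R) : measurable E ->
  mu.-integrable E (EFin \o f) -> mu.-integrable E (EFin \o g) ->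
  mu.-integrable E (EFin \o (fun y => f y + g y)).
Proof.
by move=> mE i j; have := integrableD mE i j; apply: eq_integrable => // y _.
Qed.

End restriction.

Section main_inequality.
Context {R : realType} {n : nat}.
Local Notation mu := (lebesgue_rV n.+1).
Variables (alpha : R) (u : 'rV[R]_n.+1 -> R) (l : R) (x : 'rV[R]_n.+1).
Hypothesis alpha01 : 0 < alpha < 1.
Local Notation b := (2 * alpha).
Local Notation p := (n.+1%:R + 2 * alpha).
Local Notation w := (adiff u l).
Local Notation d := (x ord0 ord0 - l).
Local Notation Q := (spike b (2 * l) x).
Local Notation H := (halfsp l).

Hypothesis lx : l < x ord0 ord0.
Hypothesis dx : fraclap_defined alpha u x.
Hypothesis drx : fraclap_defined alpha u (refl l x).
Hypothesis wx : w x <= 0.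

Variables (eps s Qm c c2 : R) (B A : set 'rV[R]_n.+1).
Hypotheses (eps0 : 0 <= eps) (s0 : 0 < s) (Qm0 : 0 <= Qm) (c0 : 0 < c).
Hypothesis sd : s <= d.
Hypothesis mB : measurable B.
Hypothesis mA : measurable A.
Hypothesis fB : (mu B < +oo)%E.
Hypothesis hmin : forall y, H y -> B y -> w x - w y <= - (eps * Q y).
Hypothesis hout : forall y, H y -> ~ B y -> 0 <= w y.
Hypothesis AH : A `<=` H.
Hypothesis AB : A `<=` B.
Hypothesis hA : forall y, A y -> 2 * c <= w y.
Hypothesis hQ : forall y, B y -> `|Q y| <= Qm.
Hypothesis hQc : eps * Qm <= c.
Hypothesis hball : forall y, enorm (x - y) < s -> B y.
Hypothesis hker : forall y, A y -> 0 < enorm (x - y) -> c2 <= ker p x y - ker p x (refl l y).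

Let p0 : 0 < p.
Proof. by rewrite addr_gt0 ?ltr0n// mulr_gt0//; case/andP: alpha01. Qed.

Let b02 : 0 < b < 2.
Proof. by apply/andP; move/andP: alpha01 => [? ?]; split; lra. Qed.

Let d0 : 0 < d. Proof. by rewrite subr_gt0. Qed.

(** A box between the plane and [x], of size comparable to the distance [d] of [x]
    to the plane. The zeroth order term [2 * w x * ker p x (refl l y)] integrated over
    it produces [d `^ (- b)], which is large when [x] is close to the plane. *)
Definition strip : set 'rV[R]_n.+1 :=
  obox (\row_i (if i == ord0 then l else x ord0 i - d))
       (\row_i (if i == ord0 then l + d / 2 else x ord0 i + d)).

Definition strip_ker : R := (2 * n.+1%:R * d) `^ (- p).

Lemma strip_halfsp y : strip y -> H y.
Proof. by move=> /(_ ord0); rewrite !mxE eqxx /halfsp/= => /andP[]. Qed.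

Lemma strip_dist y : strip y -> d / 2 <= enorm (x - y).
Proof.
move=> /(_ ord0); rewrite !mxE eqxx => /andP[h1 h2].
apply: le_trans (coord_le_enorm _ ord0); rewrite !mxE.
by apply: le_trans (ler_norm _); move: h1 h2; lra.
Qed.

Lemma strip_ker_le y : strip y -> strip_ker <= ker p x (refl l y).
Proof.
move=> hy; apply: ker_ge => //.
  apply: lt_le_trans (enorm_refl_dist (ltW lx) _) => //.
  by apply: ltW; exact: strip_halfsp.
rewrite -ler_sqr ?nnegrE ?enorm_ge0//; last by rewrite !mulr_ge0// ltW.
apply: (@le_trans _ _ (n.+1%:R * (2 * d) ^+ 2)).
  apply: enorm_le_coord; first by rewrite mulr_ge0// ltW.
  move=> i; have := hy i; rewrite !mxE; case: (i == ord0) / eqP => [->|_].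
    by move=> /andP[h1 h2]; rewrite ler_norml; lra.
  by move=> /andP[h1 h2]; rewrite ler_norml; lra.
rewrite (_ : 2 * n.+1%:R * d = n.+1%:R * (2 * d)); last by ring.
rewrite [leRHS]exprMn ler_wpM2r ?sqr_ge0// expr2 ler_peMl ?ler0n//.
by rewrite ler1n.
Qed.

Lemma mu_strip : mu strip = (2^-1 * 2 ^+ n * d ^+ n.+1)%:E.
Proof.
rewrite mu_obox; last by move=> i; rewrite !mxE; case: (i == ord0); move: d0; lra.
congr EFin; rewrite big_ord_recl !mxE eqxx.
rewrite (eq_bigr (fun=> 2 * d)); last first.
  by move=> i _; rewrite !mxE eq_sym (negbTE (neq_lift _ _)); ring.
by rewrite prodr_const card_ord exprMn exprS; field.
Qed.

Definition strip_const : R := 2^-1 * 2 ^+ n * (2 * n.+1%:R) `^ (- p).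

Lemma strip_const_gt0 : 0 < strip_const.
Proof. by rewrite !mulr_gt0 ?invr_gt0 ?exprn_gt0 ?powR_gt0 ?mulr_gt0. Qed.

Lemma strip_mass : strip_ker * fine (mu strip) = strip_const * d `^ (- b).
Proof.
rewrite mu_strip /= /strip_ker /strip_const powRM ?(ltW d0)//.
have -> : d `^ (- b) = d `^ (- p) * d ^+ n.+1.
  rewrite -powR_mulrn ?(ltW d0)// -powRD; first by congr (_ `^ _); ring.
  by rewrite (gt_eqF d0) implybT.
move: (d `^ _) (_ `^ _) (d ^+ _) (2 ^+ n) => D E F G; ring.
Qed.

Section fixed_radius.
Variables (e eta : R).
Hypotheses (e0 : 0 < e) (es : e <= s / 2) (eta0 : 0 <= eta) (etac : eta < 2 * c).
Hypothesis heta : forall y, enorm (x - y) < e -> w y <= eta.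

Local Notation D := (off_ball x e).
Local Notation E := (H `&` D).

Let ed : e <= d / 2. Proof. by apply: le_trans es _; rewrite ler_pM2r. Qed.

Let mE : measurable E.
Proof. by apply: measurableI; [exact: measurable_halfsp|exact: measurable_off_ball]. Qed.

Let annE : ann x e s `<=` E.
Proof.
move=> y /annP/andP[h1 h2]; split => //.
have := le_lt_trans (coord_le_enorm (x - y) ord0) h2.
by rewrite !mxE ltr_norml /halfsp/= => /andP[_]; move: sd; lra.
Qed.

Let AE : A `<=` E.
Proof.
move=> y Ay; split; first exact: AH.
rewrite /off_ball/= leNgt; apply/negP => /heta; apply/negP; rewrite -ltNge.
exact: lt_le_trans etac (hA Ay).
Qed.

Let stripE : strip `<=` E.
Proof.
move=> y hy; split; first exact: strip_halfsp.
by apply: le_trans ed _; exact: strip_dist.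
Qed.

Let BE := B `&` E.
Let mBE : measurable BE. Proof. exact: measurableI. Qed.

Let f1 y := eps * (- Q y * ker p x y).
Let a2 := eps * Qm * s `^ (- p).
Let a3 := - (c * c2).
Let a4 := 2 * w x * strip_ker.
Let U y := (f1 \_ (ann x e s)) y + (cst a2 \_ BE) y + (cst a3 \_ A) y + (cst a4 \_ strip) y.

(** On the ball of radius [s] the minimality of [x] is used through the cusp; the
    mirror kernel and the part of [B] outside of the ball see a bounded kernel and
    go into the term [a2]; [A] carries the gain. *)
Let folded_majorant y : E y -> folded_kernel alpha u l x y <= U y.
Proof.
move=> Ey; have [Hy Dy] := Ey; have Hy' : l < y ord0 ord0 := Hy.
have xy0 : 0 < enorm (x - y) by exact: lt_le_trans e0 Dy.
have sp0 : 0 <= s `^ (- p) := powR_ge0 _ _.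
have K0 := ker_ge0 p x y; have K'0 := ker_ge0 p x (refl l y).
have GK := ker_anti p0 (ltW lx) (ltW Hy') xy0.
have K's : ker p x (refl l y) <= s `^ (- p).
  by apply: ker_le => //; apply: le_trans sd _; exact: enorm_refl_dist (ltW lx) (ltW Hy').
have Ks : s <= enorm (x - y) -> ker p x y <= s `^ (- p) by exact: ker_le.
have h1 := hmin Hy; have h2 := hout Hy; have h3 := @hA y; have h4 := @hQ y.
have h5 := fun Ay => @hker y Ay xy0; have h6 := @strip_ker_le y.
rewrite /U /folded_kernel /f1 /a2 /a3 /a4 !patchE /=.
move: (ker p x y) (ker p x (refl l y)) (s `^ (- p)) (Q y) (w y) (w x) strip_ker
  wx sp0 K0 K'0 GK K's Ks h1 h2 h3 h4 h5 h6.
move=> K K' S q wy W SK wx0 S0 K0 K'0 GK K's Ks h1 h2 h3 h4 h5 h6.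
rewrite (_ : (if y \in ann x e s then _ else _) =
  if enorm (x - y) < s then eps * (- q * K) else 0); last first.
  by congr (if _ then _ else _); apply/idP/idP => [/set_mem/annP/andP[]//|h];
    apply/mem_set/annP; rewrite Dy.
rewrite (_ : (y \in BE) = (y \in B)); last first.
  by apply/idP/idP => /set_mem h; apply/mem_set; [case: h|].
apply: lerD; last first.
  case: ifPn => [/set_mem/h6 hs|_].
    by apply: ler_wnM2l hs; rewrite pmulr_rle0.
  by apply: mulr_le0_ge0 K'0; rewrite pmulr_rle0.
have G0 : 0 <= K - K' by rewrite subr_ge0.
have [By|nBy] := boolP (y \in B); last first.
  have nB : ~ B y by move=> By; move/negP: nBy; apply; exact: mem_set.
  rewrite ifF; last by apply/negbTE/negP => /hball.
  rewrite ifF; last by apply/negbTE/negP => /set_mem/AB.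
  by rewrite !addr0; apply: mulr_le0_ge0 G0; rewrite subr_le0; apply: le_trans wx0 _; exact: h2.
have {}By := set_mem By; have aQ := h4 By.
have eQ : eps * `|q| <= eps * Qm by exact: ler_wpM2l.
have qc : eps * q <= eps * Qm by apply: le_trans eQ; apply: ler_wpM2l => //; exact: ler_norm.
have qc' : - (eps * q) <= eps * Qm.
  by apply: le_trans eQ; rewrite -mulrN; apply: ler_wpM2l => //; rewrite -normrN ler_norm.
have eQ0 : 0 <= eps * Qm by exact: mulr_ge0.
have T3 : - (eps * q) * (K - K') <= (if enorm (x - y) < s then eps * (- q * K) else 0) + eps * Qm * S.
  have [xys|xys] := ltP.
    have t1 : eps * q * K' <= eps * Qm * K' by exact: ler_wpM2r.
    have t2 : eps * Qm * K' <= eps * Qm * S by exact: ler_wpM2l.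
    have t3 := le_trans t1 t2.
    rewrite (_ : - (eps * q) * (K - K') = eps * (- q * K) + eps * q * K'); last by ring.
    by rewrite lerD2l.
  rewrite add0r.
  have t1 : - (eps * q) * (K - K') <= eps * Qm * (K - K') by exact: ler_wpM2r.
  apply: (le_trans t1); apply: ler_wpM2l => //.
  by apply: le_trans (Ks xys); rewrite gerBl.
apply: le_trans (lerD T3 (lexx _)).
case: ifPn => [/set_mem Ay|_]; last first.
  by rewrite addr0; apply: ler_wpM2r => //; exact: h1.
have t4 : W - wy <= - (eps * q) - c.
  have := h3 Ay; have := le_trans qc hQc; move: wx0.
  by move: (eps * q) => a; lra.
apply: (le_trans (ler_wpM2r G0 t4)).
by rewrite mulrDl lerD2l mulNr lerN2; apply: ler_wpM2l; [exact: ltW|exact: h5].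
Qed.

Let fA : (mu A < +oo)%E.
Proof. by apply: le_lt_trans fB; apply: le_measure => //; rewrite inE. Qed.

Let fBE : (mu BE < +oo)%E.
Proof. by apply: le_lt_trans fB; apply: le_measure => //; rewrite ?inE//; exact: subIsetl. Qed.

Let fstrip : (mu strip < +oo)%E.
Proof. by rewrite mu_strip ltry. Qed.

Let ms : measurable strip. Proof. exact: measurable_obox. Qed.

Let i1 : mu.-integrable (ann x e s) (EFin \o (fun y => - Q y * ker p x y)).
Proof. exact: integrable_spike. Qed.

Let if1 : mu.-integrable (ann x e s) (EFin \o f1).
Proof.
have := integrableZl (measurable_ann x e s) eps i1.
by apply: eq_integrable => //; exact: measurable_ann.
Qed.

Let i2 : mu.-integrable E (EFin \o (f1 \_ (ann x e s))).
Proof. by apply: integrable_patch => //; exact: measurable_ann. Qed.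

Let i3 : mu.-integrable E (EFin \o (cst a2 \_ BE)).
Proof. by apply: integrable_patch => //; [exact: subIsetr|exact: integrable_cst_fin]. Qed.

Let i4 : mu.-integrable E (EFin \o (cst a3 \_ A)).
Proof. by apply: integrable_patch => //; exact: integrable_cst_fin. Qed.

Let i5 : mu.-integrable E (EFin \o (cst a4 \_ strip)).
Proof. by apply: integrable_patch => //; exact: integrable_cst_fin. Qed.

Let i23 : mu.-integrable E (EFin \o (fun y => (f1 \_ (ann x e s)) y + (cst a2 \_ BE) y)).
Proof. exact: integrable_addR mE i2 i3. Qed.

Let i234 : mu.-integrable E
  (EFin \o (fun y => (f1 \_ (ann x e s)) y + (cst a2 \_ BE) y + (cst a3 \_ A) y)).
Proof. exact: integrable_addR mE i23 i4. Qed.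

Let iU : mu.-integrable E (EFin \o U).
Proof. exact: integrable_addR mE i234 i5. Qed.

Lemma folded_integral_le :
  \int[mu]_(y in E) folded_kernel alpha u l x y <=
  eps * \int[mu]_(y in ann x e s) (- Q y * ker p x y)
  + eps * Qm * s `^ (- p) * fine (mu B) - c * c2 * fine (mu A)
  + 2 * w x * (strip_const * d `^ (- b)).
Proof.
have ed' : e <= d by apply: le_trans ed _; move: d0; lra.
have iPhi := integrable_folded dx drx e0 ed'.
apply: le_trans (le_Rintegral mE iPhi iU folded_majorant) _.
have E1 := RintegralD mE i234 i5.
have E2 := RintegralD mE i23 i4.
have E3 := RintegralD mE i2 i3.
have E4 := RintegralZl eps (measurable_ann x e s) i1.
have R1 := @Rintegral_patch _ _ _ mu E (ann x e s) f1 annE.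
have R2 := @Rintegral_patch _ _ _ mu E BE (cst a2) (@subIsetr _ _ _).
have R3 := @Rintegral_patch _ _ _ mu E A (cst a3) AE.
have R4 := @Rintegral_patch _ _ _ mu E strip (cst a4) stripE.
have V2 := Rintegral_cst mu mBE a2.
have V3 := Rintegral_cst mu mA a3.
have V4 := Rintegral_cst mu ms a4.
rewrite [leLHS]E1 E2 E3 R1 R2 R3 R4 [X in X + _ + _ + _]E4 [X in _ + X + _ + _]V2 [X in _ + X + _]V3 [X in _ + X <= _]V4.
apply: lerD; last first.
  by rewrite /a4 -mulrA strip_mass.
rewrite /a3 mulNr lerD2r lerD2l /a2; apply: ler_wpM2l.
  by rewrite !mulr_ge0 ?powR_ge0.
apply: fine_le; rewrite ?ge0_fin_numE//.
by apply: le_measure; rewrite ?inE//; exact: subIsetl.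
Qed.

Lemma trunc_le :
  fraclap_trunc alpha u (refl l x) e - fraclap_trunc alpha u x e <=
  eps * \int[mu]_(y in ann x e s) (- Q y * ker p x y)
  + eps * Qm * s `^ (- p) * fine (mu B) - c * c2 * fine (mu A)
  + 2 * w x * (strip_const * d `^ (- b))
  + eta * d `^ (- p) * (2 * e) ^+ n.+1.
Proof.
have ed' : e <= d by apply: le_trans ed _; move: d0; lra.
have E1 := trunc_diff dx drx e0.
rewrite [leLHS]E1.
have h := antisym_trunc p0 lx dx drx e0 ed' wx eta0.
apply: (le_trans (h _)).
  by move=> y /heta hy; rewrite -[leRHS]add0r; exact: lerD.
by apply: lerD => //; exact: folded_integral_le.
Qed.

End fixed_radius.

Hypothesis hcont : forall eta : R, 0 < eta ->
  exists2 e : R, 0 < e & forall y, enorm (x - y) < e -> w y <= eta.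

Let I (e : R) := fraclap_trunc alpha u (refl l x) e - fraclap_trunc alpha u x e.

Let cvgI : I e @[e --> 0^'+] --> fraclap alpha u (refl l x) - fraclap alpha u x.
Proof.
have [_ c1] := dx; have [_ c3] := drx.
exact: (@cvgB _ _ _ _ _ (fraclap_trunc alpha u (refl l x)) (fraclap_trunc alpha u x) _ _ c3 c1).
Qed.

(** Let the radius of the truncation tend to 0 in [trunc_le]; away from the cusp the
    singular integral is bounded by [spike_integral_le]. *)
Lemma fraclap_diff_le : eps = 0 \/ x ord0 ord0 != 2 * l ->
  fraclap alpha u (refl l x) - fraclap alpha u x <=
  eps * (@outer_const R n b + @inner_const R n b) + eps * Qm * s `^ (- p) * fine (mu B)
  - c * c2 * fine (mu A) + 2 * w x * (strip_const * d `^ (- b)).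
Proof.
move=> heps; apply/ler_addgt0Pr => delta delta0.
rewrite -(cvg_lim (@Rhausdorff R) cvgI).
apply: limr_le; first exact: cvgP cvgI.
have dp0 : 0 < d `^ p by rewrite powR_gt0.
(* the second bound makes the excess of the folded integrand at most delta *)
pose eta := Num.min c (delta * d `^ p).
have eta0 : 0 < eta by rewrite lt_min c0 mulr_gt0.
have [e1 e10 he1] := hcont eta0.
near=> e.
have e0 : 0 < e by near: e; exact: nbhs_right_gt.
have es : e <= s / 2 by apply/ltW; near: e; apply: nbhs_right_lt; rewrite divr_gt0.
have eh : e <= 2^-1 by apply/ltW; near: e; apply: nbhs_right_lt; rewrite invr_gt0.
have ee1 : e <= e1 by apply/ltW; near: e; exact: nbhs_right_lt.
have etac : eta < 2 * c.
  by apply: (@le_lt_trans _ _ c); [rewrite ge_min lexx|rewrite mulrC ltr_pMr// ltr1n].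
have h := trunc_le e0 es (ltW eta0) etac (fun y hy => he1 y (lt_le_trans hy ee1)).
apply: (le_trans h); apply: lerD; last first.
  apply: (@le_trans _ _ (delta * d `^ p * d `^ (- p) * 1)).
    apply: ler_pM.
    - by rewrite mulr_ge0 ?powR_ge0// ltW.
    - by rewrite exprn_ge0// mulr_ge0// ltW.
    - by apply: ler_wpM2r; [exact: powR_ge0|rewrite ge_min lexx orbT].
    - rewrite exprn_ile1//; first by rewrite mulr_ge0// ltW.
      by rewrite mulrC -ler_pdivlMr// mul1r.
  by rewrite mulr1 powRN -mulrA divff ?mulr1// gt_eqF.
rewrite !lerD2r; case: heps => [->|xl]; first by rewrite !mul0r.
by apply: ler_wpM2l => //; apply: spike_integral_le.
Unshelve. all: by end_near. Qed.

(** On the cusp the upper bound of [trunc_le] tends to minus infinity as the radius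
    shrinks dyadically, although the truncations converge. *)
Lemma no_spike_minimum : 0 < eps -> x ord0 ord0 = 2 * l -> False.
Proof.
move=> epsp xl.
pose L := fraclap alpha u (refl l x) - fraclap alpha u x.
have [e1 e10 he1] := hcont c0.
pose C1 := eps * Qm * s `^ (- p) * fine (mu B) - c * c2 * fine (mu A)
    + 2 * w x * (strip_const * d `^ (- b)).
pose C2 := c * d `^ (- p).
have C20 : 0 <= C2 by rewrite mulr_ge0 ?powR_ge0// ltW.
have hL : \forall e \near 0^'+, L - 1 <= I e.
  by apply: (cvgr_ge _ cvgI); rewrite ltrBlDr ltrDl.
have [e2 /= e20 he2] := hL.
pose e3 := Num.min (Num.min e1 (e2 / 2)) (Num.min (s / 2) 2^-1).
have e30 : 0 < e3.
  by rewrite !lt_min e10 (divr_gt0 e20)//= (divr_gt0 s0)//= invr_gt0.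
have [k hk] := archi_pow2 s e30.
have Cd : 0 < @annulus_const R n b by exact: annulus_const_gt0.
pose M := (C1 + C2 - L + 1) / (eps * @annulus_const R n b).
pose k' := maxn k (Num.truncn `|M|).+1.
have hk' : s <= 2 ^+ k' * e3.
  apply: (le_trans hk); apply: ler_wpM2r; first exact: ltW.
  by rewrite ler_weXn2l ?ler1n// leq_maxl.
have hM : M < k'%:R.
  apply: le_lt_trans (ler_norm _) _; apply: lt_le_trans (truncnS_gt _) _.
  by rewrite ler_nat leq_maxr.
pose e := s / 2 ^+ k'.
have pk : 0 < 2 ^+ k' :> R by rewrite exprn_gt0.
have e0 : 0 < e by rewrite divr_gt0.
have ee3 : e <= e3 by rewrite ler_pdivrMr// mulrC.
have [] : [/\ e <= e1, e <= e2 / 2, e <= s / 2 & e <= 2^-1].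
  by move: ee3; rewrite !le_min => /andP[/andP[-> ->] /andP[-> ->]].
move=> ee1 ee2 es eh.
have h1 : L - 1 <= I e.
  apply: he2 => //=; rewrite sub0r normrN gtr0_norm//.
  by apply: le_lt_trans ee2 _; rewrite ltr_pdivrMr// ltr_pMr// ltr1n.
have etac : c < 2 * c by rewrite mulrC ltr_pMr// ltr1n.
have h2 := trunc_le e0 es (ltW c0) etac (fun y hy => he1 y (lt_le_trans hy ee1)).
have h3 := @spike_integral_diverges R n b b02 (2 * l) x s k' s0 xl.
have h4 : c * d `^ (- p) * (2 * e) ^+ n.+1 <= C2.
  rewrite -[leRHS]mulr1; apply: ler_wpM2l => //.
  rewrite exprn_ile1//; first by rewrite mulr_ge0// ltW.
  by rewrite mulrC -ler_pdivlMr// mul1r.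
have h5 : C1 + C2 - L + 1 < k'%:R * (eps * @annulus_const R n b).
  by rewrite -ltr_pdivrMr// mulr_gt0.
have h6 := ler_wpM2l (ltW epsp) h3.
have h7 : I e <= eps * \int[mu]_(y in ann x (s / 2 ^+ k') s) (- Q y * ker p x y) + C1 + C2.
  apply: (le_trans h2); apply: lerD => //; rewrite -/e /C1.
  by rewrite !addrA.
have : L - 1 <= eps * - (k'%:R * @annulus_const R n b) + C1 + C2.
  apply: (le_trans h1); apply: (le_trans h7).
  by rewrite !lerD2r.
move=> h8; have := ltr_leD h5 h8; rewrite [X in X < _](_ : _ = C1 + C2); last by ring.
by rewrite [X in _ < X](_ : _ = C1 + C2) ?ltxx//; ring.
Qed.

End main_inequality.

(** * Kernel gap, Lipschitz constants, uniform continuity *)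

Section kernel_gap.
Context {R : realType} {n : nat}.
Implicit Types (x y : 'rV[R]_n.+1) (l p S h : R).

Definition kernel_gap p S h : R :=
  (S ^+ 2) `^ (- (p / 2)) * (1 - (S ^+ 2 / (S ^+ 2 + h)) `^ (p / 2)).

Lemma kernel_gap_gt0 p S h : 0 < p -> 0 < S -> 0 < h -> 0 < kernel_gap p S h.
Proof.
move=> p0 S0 h0; have S20 : 0 < S ^+ 2 by rewrite exprn_gt0.
rewrite mulr_gt0 ?powR_gt0// subr_gt0.
have q0 : 0 < p / 2 by rewrite divr_gt0.
have := @gt0_ltr_powR R (p / 2) q0 (S ^+ 2 / (S ^+ 2 + h)) 1; rewrite powR1; apply.
- by rewrite nnegrE divr_ge0 ?addr_ge0 ?ltW.
- by rewrite nnegrE.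
- by rewrite ltr_pdivrMr ?addr_gt0// mul1r ltrDl.
Qed.

(** With [q = p / 2] the difference is
    [s `^ (- q) * (1 - (s / (s + h')) `^ q)], where [s] is the squared distance of [x]
    and [y]; both factors decrease when [s] grows to [S ^+ 2] and [h'] shrinks to [h]. *)
Lemma ker_diff_ge p l x y S h : 0 < p -> 0 < S -> 0 < h ->
  0 < enorm (x - y) -> enorm (x - y) <= S ->
  h <= 4 * (x ord0 ord0 - l) * (y ord0 ord0 - l) ->
  kernel_gap p S h <= ker p x y - ker p x (refl l y).
Proof.
move=> p0 S0 h0 xy0 xyS hh.
have q0 : 0 < p / 2 by rewrite divr_gt0.
have kE (r : R) : 0 <= r -> (r `^ p)^-1 = (r ^+ 2) `^ (- (p / 2)).
  move=> r0; rewrite -powRN -powR_mulrn// -powRrM; congr (_ `^ _); by field.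
rewrite /ker !kE ?enorm_ge0// enorm_refl.
set s := enorm (x - y) ^+ 2; set h' := _ * _ * _ in hh *.
have s0 : 0 < s by rewrite exprn_gt0.
have sS : s <= S ^+ 2 by rewrite lerXn2r ?nnegrE ?enorm_ge0// ltW.
have S20 : 0 < S ^+ 2 by rewrite exprn_gt0.
have h'0 : 0 < h' by exact: lt_le_trans hh.
have E : (s + h') `^ (- (p / 2)) = s `^ (- (p / 2)) * (s / (s + h')) `^ (p / 2).
  rewrite powRM ?invr_ge0 ?(ltW s0)//; last by rewrite addr_ge0// ltW.
  rewrite mulrA -powRD; last by rewrite (gt_eqF s0) implybT.
  rewrite addNr powRr0 mul1r -[(s + h')^-1]powR_inv1; last by rewrite addr_ge0// ltW.
  by rewrite -powRrM mulN1r.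
rewrite E -[X in X - _]mulr1 -mulrBr /kernel_gap.
have le1 : (s / (s + h')) `^ (p / 2) <= (S ^+ 2 / (S ^+ 2 + h)) `^ (p / 2).
  have sh0 : 0 <= s + h' by rewrite addr_ge0// ltW.
  have Sh0 : 0 <= S ^+ 2 + h by rewrite addr_ge0// ltW.
  rewrite ge0_ler_powR ?nnegrE ?divr_ge0 ?(ltW q0) ?(ltW p0) ?(ltW s0) ?(ltW S20)//.
  rewrite ler_pdivrMr ?addr_gt0// mulrAC ler_pdivlMr ?addr_gt0//.
  rewrite !mulrDr mulrC lerD2l; apply: ler_pM => //; exact: ltW.
have le2 : (S ^+ 2 / (S ^+ 2 + h)) `^ (p / 2) <= 1.
  have := @ge0_ler_powR R (p / 2) (ltW q0) (S ^+ 2 / (S ^+ 2 + h)) 1; rewrite powR1; apply.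
  - by rewrite nnegrE divr_ge0 ?addr_ge0 ?ltW.
  - by rewrite nnegrE.
  - by rewrite ler_pdivrMr ?addr_gt0// mul1r lerDl ltW.
apply: ler_pM; [exact: powR_ge0|by rewrite subr_ge0| |by rewrite lerD2l lerN2].
rewrite !powRN lef_pV2 ?posrE ?powR_gt0//.
by rewrite ge0_ler_powR ?nnegrE ?(ltW q0)// ltW.
Qed.

End kernel_gap.

Section topology.
Context {R : realType}.

(** The hypothesis is local on pairs of points, also off the diagonal, so a
    covering argument on the square of the segment gives one constant for all pairs. *)
Lemma lipschitz_segment (f : R -> R) (M : R) :
  [locally [lipschitz f t | t in [set t : R | 0 <= t]]] ->
  exists2 L : R, 0 <= L & forall a b, 0 <= a <= M -> 0 <= b <= M ->
    `|f a - f b| <= L * `|a - b|.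
Proof.
move=> lipf.
have cK : compact (`[0, M]%classic `*` `[0, M]%classic : set (R * R)).
  by apply: compact_setX; exact: segment_compact.
pose P (L : R) (z : R * R) := `|f z.1 - f z.2| <= L * `|z.1 - z.2|.
have := (near_covering_withinP _).2 ((compact_near_coveringP _).1 cK) R (+oo) P _.
case.
- move=> [a b] [/=]; rewrite !in_itv/= => /andP[a0 aM] /andP[b0 bM].
  have := lipf (a, b) (conj a0 b0).
  move=> [M0 [_ hM0]]; pose L1 := M0 + 1.
  have HL1 := hM0 L1 (ltr_pwDr ltr01 (lexx M0)).
  exists ([set z | ([set t : R | 0 <= t] `*` [set t : R | 0 <= t]) z ->
    `|f z.1 - f z.2| <= L1 * `|z.1 - z.2|], [set i : R | L1 <= i]).
    split => /=; first exact: HL1.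
    by exists L1; split; [exact: num_real|move=> i /ltW].
  move=> [[a' b'] i] /= [h1 h2]; rewrite !in_itv/= => -[/andP[a'0 _] /andP[b'0 _]].
  by apply: (le_trans (h1 (conj a'0 b'0))); exact: ler_wpM2r.
- move=> L [_ hL]; exists (`|L| + 1); first by rewrite addr_ge0.
  move=> a b' ha hb; apply: (hL _ _ (a, b')).
    by rewrite ltr_pwDr// ler_norm.
  by split; rewrite /= in_itv.
Qed.

Lemma continuous_norm_powR (b c : R) : 0 < b -> continuous (fun t : R => `|t - c| `^ b).
Proof.
move=> b0.
suff H : continuous (fun t : R => `|t| `^ b).
  move=> t; apply: (@continuous_comp _ _ _ (fun t => t - c) (fun t => `|t| `^ b)).
    by apply: cvgB => //; exact: cvg_cst.
  exact: H.
move=> t; have [->|t0] := eqVneq t 0.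
  apply/cvgrPdist_le => e e0.
  have ie0 : 0 < e `^ b^-1 by rewrite powR_gt0.
  exists (e `^ b^-1) => // y /=; rewrite sub0r normrN => ye.
  rewrite normr0 powR0 ?gt_eqF// sub0r normrN ger0_norm ?powR_ge0//.
  rewrite [leRHS](_ : e = (e `^ b^-1) `^ b); last first.
    by rewrite -powRrM mulVf ?gt_eqF// powRr1// ltW.
  by rewrite ge0_ler_powR ?nnegrE ?(ltW b0) ?powR_ge0// ltW.
have at0 : 0 < `|t| by rewrite normr_gt0.
apply: (@continuous_comp _ _ _ (fun t : R => `|t|) (fun t : R => t `^ b)).
  exact: norm_continuous.
apply: differentiable_continuous; apply/derivable1_diffP.
by apply: derivable_powR; rewrite in_itv/= andbT.
Qed.

End topology.

Section sup_norm.
Context {R : realType} {n : nat}.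
Local Notation mu := (lebesgue_rV n.+1).
Implicit Types (x y : 'rV[R]_n.+1) (l r : R).

Lemma norm_le_coord x r : 0 <= r -> (forall i, `|x ord0 i| <= r) -> `|x| <= r.
Proof.
move=> r0 h; rewrite [leLHS]/Num.norm/= mx_normrE; apply/bigmax_leP; split => //= i _.
by rewrite (ord1 i.1).
Qed.

Lemma coord_le_norm x i : `|x ord0 i| <= `|x|.
Proof.
rewrite [leRHS]/Num.norm/= mx_normrE; apply/bigmax_geP; right => /=.
by exists (ord0, i).
Qed.

Lemma norm_le_enorm x : `|x| <= enorm x.
Proof. by apply: norm_le_coord; [exact: enorm_ge0|exact: coord_le_enorm]. Qed.

Lemma norm_refl_refl l l' x : `|refl l x - refl l' x| <= 2 * `|l - l'|.
Proof.
apply: norm_le_coord => [|i]; first by rewrite mulr_ge0.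
rewrite !mxE; case: (i == ord0); last by rewrite subrr normr0 mulr_ge0.
by rewrite (_ : _ - _ = 2 * (l - l')); [rewrite normrM ger0_norm|ring].
Qed.

Lemma norm_refl_id l x : `|refl l x - x| <= 2 * `|x ord0 ord0 - l|.
Proof.
apply: norm_le_coord => [|i]; first by rewrite mulr_ge0.
rewrite !mxE; case: eqP => [->|_]; last by rewrite subrr normr0 mulr_ge0.
by rewrite (_ : _ - _ - _ = - (2 * (x ord0 ord0 - l))); [rewrite normrN normrM ger0_norm|ring].
Qed.

Lemma norm_refl2 l x y : `|refl l x - refl l y| <= `|x - y|.
Proof.
apply: norm_le_coord => // i.
have := coord_le_norm (x - y) i; rewrite !mxE; case: (i == ord0) => //.
by rewrite (_ : 2 * l - _ - _ = - (x ord0 i - y ord0 i)) ?normrN//; ring.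
Qed.

Definition cbox (r : R) : set 'rV[R]_n.+1 := [set y | `|y| <= r].

Lemma measurable_cbox r : measurable (cbox r).
Proof.
have [r0|r0] := leP 0 r; last first.
  rewrite (_ : cbox r = set0); first exact: measurable0.
  by rewrite -subset0 => y /= h; have := le_lt_trans (le_trans (normr_ge0 y) h) r0; rewrite ltxx.
rewrite (_ : cbox r = \bigcap_(i in [set: 'I_n.+1])
   [set y : 'rV[R]_n.+1 | y ord0 i \in `[- r, r] ]).
  by apply: fin_bigcap_measurable => // i _; exact: measurable_coord_itv.
apply/seteqP; split => [y h i _ /=|y h].
  by rewrite in_itv/= -ler_norml; apply: le_trans h; exact: coord_le_norm.
apply: norm_le_coord => // i.
by have := h i I; rewrite /= in_itv/= -ler_norml.
Qed.

Lemma mu_cbox_fin r : (mu (cbox r) < +oo)%E.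
Proof.
apply: (@le_lt_trans _ _ (mu (cube 0 (`|r| + 1)))).
  apply: le_measure; rewrite ?inE; [exact: measurable_cbox|exact: measurable_obox|].
  move=> y h; apply/cubeP => i; rewrite mxE sub0r normrN.
  apply: (@le_lt_trans _ _ `|r|); last by rewrite ltrDl.
  by apply: le_trans (coord_le_norm y i) _; apply: le_trans h _; exact: ler_norm.
by rewrite mu_cube ?ltry// addr_ge0.
Qed.

Lemma compact_cbox r : compact (cbox r).
Proof.
apply: bounded_closed_compact.
  exists r; split; first exact: num_real.
  by move=> M rM y h; apply: le_trans h (ltW rM).
apply: (@preimage_closed _ _ (fun y : 'rV[R]_n.+1 => `|y|) [set t | t <= r]).
  by move=> y _; exact: norm_continuous.
exact: closed_le.
Qed.

(** A covering argument on a ball slightly larger than the support; off this ball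
    both values vanish when the points are close. *)
Lemma compact_support_uniform (u : 'rV[R]_n.+1 -> R) r : continuous u ->
  (forall x, r <= `|x| -> u x = 0) -> forall e : R, 0 < e ->
  exists2 d : R, 0 < d & forall x y, `|x - y| < d -> `|u x - u y| <= e.
Proof.
move=> cu u0 e e0.
pose P (d : R) (x : 'rV[R]_n.+1) := forall y, `|x - y| < d -> `|u x - u y| <= e.
have h := ((compact_near_coveringP _).1 (@compact_cbox (r + 1))) R (0^'+) P _.
have {}h : \forall d \near 0^'+, cbox (r + 1) `<=` P d.
  apply: h => x _.
  have := cu x => /cvgrPdist_le /(_ (e / 2)); rewrite divr_gt0// => /(_ isT).
  move=> /nbhs_ballP[d /= d0 hd].
  have hd' y : `|x - y| < d -> `|u x - u y| <= e / 2.
    by move=> xy; apply: hd; rewrite -ball_normE.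
  exists (ball x (d / 2), [set i : R | 0 < i < d / 2]).
    split => /=; first by apply: nbhsx_ballx; rewrite divr_gt0.
    near=> i; apply/andP; split; first by near: i; exact: nbhs_right_gt.
    by near: i; apply: nbhs_right_lt; rewrite divr_gt0.
  move=> [x' i] /= [+ /andP[_ id]] y xy; rewrite -ball_normE /= => xx'.
  have a1 : `|u x - u x'| <= e / 2.
    by apply: hd'; apply: lt_le_trans xx' _; rewrite ler_pdivrMr// ler_pMr// ler1n.
  have a2 : `|u x - u y| <= e / 2.
    apply: hd'; rewrite (_ : x - y = (x - x') + (x' - y)); last by rewrite addrA subrK.
    apply: le_lt_trans (ler_normD _ _) _; rewrite [ltRHS]splitr.
    by apply: ltrD => //; exact: lt_trans xy id.
  rewrite (_ : u x' - u y = (u x - u y) - (u x - u x')); last by ring.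
  by apply: le_trans (ler_normB _ _) _; rewrite [leRHS]splitr; exact: lerD.
have [d [[d0 d1] hd]] : exists d : R, (0 < d /\ d < 1) /\ cbox (r + 1) `<=` P d.
  near (0 : R)^'+ => d; exists d; split; first split.
  - by near: d; exact: nbhs_right_gt.
  - by near: d; exact: nbhs_right_lt.
  - by near: d.
exists d => // x y xy.
have [xr|xr] := leP `|x| (r + 1); first exact: hd.
have ry : r <= `|y|.
  rewrite -(lerD2r 1); apply: le_trans (ltW xr) _.
  rewrite -{1}(subrK y x) addrC; apply: le_trans (ler_normD _ _) _.
  by rewrite lerD2l; apply: ltW; exact: lt_trans xy d1.
rewrite (u0 y ry) u0 ?subrr ?normr0 ?(ltW e0)//.
by apply: le_trans (ltW xr); rewrite lerDl.
Unshelve. all: by end_near. Qed.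

Lemma half_box_min (F : 'rV[R]_n.+1 -> R) l r y1 : continuous F ->
  `|y1| <= r -> l <= y1 ord0 ord0 ->
  exists x, [/\ `|x| <= r, l <= x ord0 ord0 &
    forall y, `|y| <= r -> l <= y ord0 ord0 -> F x <= F y].
Proof.
move=> cF y1r y1l.
pose A : set 'rV[R]_n.+1 := [set y | l <= y ord0 ord0].
have cA : closed A.
  apply: (@preimage_closed _ _ (fun y : 'rV[R]_n.+1 => y ord0 ord0) [set t | l <= t]).
    by move=> y _; exact: coord_continuous.
  exact: closed_ge.
have cM : compact (cbox r `&` A).
  apply: (@subclosed_compact _ _ (cbox r)).
  - by apply: closedI => //; apply: compact_closed; [exact: norm_hausdorff|exact: compact_cbox].
  - exact: compact_cbox.
  - exact: subIsetl.
have [||x /set_mem[xr xl] hx] := @EVT_min_rV R n.+1 F (cbox r `&` A) _ cM.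
- by exists y1.
- by apply: continuous_subspaceT.
by exists x; split => // y yr yl; apply: hx; apply/mem_set.
Qed.

End sup_norm.

(** * Moving the plane *)

Lemma enorm_cbox {R : realType} {n} (rho : R) (x y : 'rV[R]_n.+1) : 0 <= rho ->
  `|x| <= rho -> `|y| <= rho -> enorm (x - y) <= n.+1%:R * (2 * rho).
Proof.
move=> rho0 hx hy; have r20 : 0 <= 2 * rho by rewrite mulr_ge0.
rewrite -ler_sqr ?nnegrE ?enorm_ge0 ?mulr_ge0//.
apply: (@le_trans _ _ (n.+1%:R * (2 * rho) ^+ 2)).
  apply: enorm_le_coord => // i; rewrite !mxE; apply: le_trans (ler_normB _ _) _.
  rewrite mulr_natl mulr2n; apply: lerD.
    exact: le_trans (coord_le_norm x i) hx.
  exact: le_trans (coord_le_norm y i) hy.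
by rewrite [leRHS]exprMn ler_wpM2r ?sqr_ge0// expr2 ler_peMl ?ler0n// ler1n.
Qed.

Lemma cube_cbox {R : realType} {n} (rho r : R) (y : 'rV[R]_n.+1) : 0 < r ->
  `|y| + r <= rho -> cube y r `<=` cbox rho.
Proof.
move=> r0 yr q /cubeP hq; apply: le_trans yr.
rewrite -[q](subKr y); apply: le_trans (ler_normB _ _) _; rewrite lerD2l.
by apply: norm_le_coord => [|i]; [exact: ltW|have := hq i; rewrite !mxE => /ltW].
Qed.

Lemma refl_continuous {R : realType} {n} (l : R) : continuous (@refl R n l).
Proof.
move=> x; apply/(@cvgrPdist_le R _ _ (nbhs x) _ (refl l)) => e e0.
apply/nbhs_ballP; exists e => // y; rewrite -ball_normE /= => /ltW.
exact: le_trans (norm_refl2 l x y).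
Qed.

Section arithmetic.
Variable R : realType.
Implicit Types A B C D L m K : R.

Lemma arith_close A m : A <= - (3 / 4 * m) -> 0 < m -> - (m / 4) <= A -> False.
Proof. lra. Qed.

Lemma arith_min A B C m : A - B <= - m - C -> 0 <= C -> B <= m / 4 -> A <= - (3 / 4 * m).
Proof. lra. Qed.

Lemma arith_spike A B C D : A - C <= B - D -> A - B <= - (D - C).
Proof. lra. Qed.

Lemma arith_narrow L A B C D m : L * C <= A + B -> A <= D -> B <= C * (L + 1) ->
  C <= - (3 / 4 * m) -> 0 < m -> D <= m / 4 -> False.
Proof.
rewrite mulrDr mulr1 [C * L]mulrC; move: (L * C) => E; lra.
Qed.

Lemma arith_wide A B C D K : C <= A - K + B -> A <= D -> B <= 0 -> - (K / 4) <= C ->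
  D <= K / 4 -> 0 < K -> False.
Proof. lra. Qed.

End arithmetic.

Section moving_planes.
Context {R : realType} {n : nat}.
Local Notation mu := (lebesgue_rV n.+1).
Variables (alpha : R) (Omega : set 'rV[R]_n.+1) (f : R -> R) (g u : 'rV[R]_n.+1 -> R).
Hypothesis halpha : 0 < alpha < 1.
Hypothesis bndOmega : bounded_set Omega.
Hypothesis convOmega : convex_x1 Omega.
Hypothesis symOmega : symmetric_set_x1 Omega.
Hypothesis lipf : [locally [lipschitz f t | t in [set t : R | 0 <= t]]].
Hypothesis symg : symmetric_x1 Omega g.
Hypothesis decg : decreasing_x1 Omega g.
Hypothesis solu : classical_solution alpha Omega f g u.
Hypothesis posu : forall x, Omega x -> 0 < u x.

Local Notation b := (2 * alpha).
Local Notation p := (n.+1%:R + 2 * alpha).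
Implicit Types (x y : 'rV[R]_n.+1) (l : R).

Let a0 : 0 < alpha. Proof. by case/andP: halpha. Qed.
Let b0 : 0 < b. Proof. by rewrite mulr_gt0. Qed.
Let p0 : 0 < p. Proof. by rewrite addr_gt0 ?ltr0n. Qed.

Let u_cont : continuous u. Proof. by case: solu. Qed.
Let u_out x : ~ Omega x -> u x = 0. Proof. by case: solu => _ _ _; apply. Qed.

Let u_ge0 x : 0 <= u x.
Proof. by have [/posu/ltW//|/u_out ->] := pselect (Omega x). Qed.

Lemma Omega_radius : exists2 r0 : R, 0 < r0 & forall x, Omega x -> `|x| < r0.
Proof.
case: bndOmega => M [_ hM]; exists (`|M| + 2); first by rewrite ltr_wpDl.
move=> x Ox; apply: (@le_lt_trans _ _ (`|M| + 1)); last by rewrite ltrD2l ltr1n.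
by apply: hM => //; rewrite ltr_pwDr// ler_norm.
Qed.

(** The reflected point lies on the segment from [x] to its mirror image in the
    plane [x1 = 0]. *)
Lemma refl_Omega l x : 0 < l -> l < x ord0 ord0 -> Omega x -> Omega (refl l x).
Proof.
move=> l0 lx; rewrite [x]pt_eta refl_pt; set a := x ord0 ord0 in lx *.
set x' := \row_i _ => Ox; have a0' : 0 < a by exact: lt_trans lx.
have := convOmega Ox (symOmega Ox) (t := l / a).
rewrite divr_gt0// ltr_pdivrMr// mul1r lx => /(_ isT).
by rewrite (_ : _ + _ = 2 * l - a)//; field; rewrite gt_eqF.
Qed.

(** The reflected point is closer to the plane [x1 = 0]. When it lies on that
    plane, which is excluded here, nothing is known: monotonicity is assumed for
    positive first coordinates only. *)
Lemma g_refl l x : 0 < l -> l < x ord0 ord0 -> Omega x -> x ord0 ord0 != 2 * l ->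
  g x <= g (refl l x).
Proof.
move=> l0 lx Ox xl; have := refl_Omega l0 lx Ox; move: Ox xl.
rewrite [x]pt_eta pt0 refl_pt; set a := x ord0 ord0 in lx *.
set x' := \row_i _ => Ox xl Orx.
have [h|h|h] := ltgtP (2 * l) a; last by rewrite h eqxx in xl.
  rewrite -(symg Orx); apply: decg => //; [exact: symOmega|lra|lra].
by apply: decg => //; lra.
Qed.

Lemma adiff_out l x : ~ Omega x -> 0 <= adiff u l x.
Proof. by move=> /u_out ux; rewrite /adiff ux subr0. Qed.

Lemma u_uniform (e : R) : 0 < e ->
  exists2 d : R, 0 < d & forall x y, `|x - y| < d -> `|u x - u y| <= e.
Proof.
have [r0 r00 hr] := Omega_radius.
apply: (@compact_support_uniform R n u r0) => // x xr.
by apply: u_out => /hr; rewrite ltNge xr.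
Qed.

Lemma u_bounded : exists M : R, forall x, u x <= M.
Proof.
have [r0 r00 hr] := Omega_radius.
have cF : continuous (fun x => - u x) by move=> x; apply: continuousN; exact: u_cont.
have [|| z [zr _ hz]] := @half_box_min R n _ (- r0) r0 0 cF.
- by rewrite normr0 ltW.
- by rewrite mxE oppr_le0 ltW.
exists (u z) => x; have [Ox|/u_out ->//] := pselect (Omega x).
rewrite -lerN2; apply: hz; first by exact/ltW/hr.
have := le_trans (coord_le_norm x ord0) (ltW (hr _ Ox)).
by rewrite ler_norml => /andP[].
Qed.

Lemma adiff_continuous_above l x : adiff u l x <= 0 -> forall eta : R, 0 < eta ->
  exists2 e : R, 0 < e & forall y, enorm (x - y) < e -> adiff u l y <= eta.
Proof.
move=> wx eta eta0; have e20 : 0 < eta / 2 by rewrite divr_gt0.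
have [d d0 hd] := u_uniform e20; exists d => // y xy.
have xy' : `|x - y| < d by apply: le_lt_trans xy; exact: norm_le_enorm.
have := hd _ _ xy'; have := hd _ _ (le_lt_trans (norm_refl2 l x y) xy').
move: wx; rewrite /adiff !ler_norml.
move: (u x) (u y) (u (refl l x)) (u (refl l y)) => A B C D.
by move=> h /andP[h1 h2] /andP[h3 h4]; lra.
Qed.

Lemma adiff_continuous l : continuous (adiff u l).
Proof.
move=> q; apply/(@cvgrPdist_le R R _ (nbhs q) _ (adiff u l)) => e e0.
have e20 : 0 < e / 2 by rewrite divr_gt0.
have [d d0 hd] := u_uniform e20; apply/nbhs_ballP; exists d => // q'.
rewrite -ball_normE /= => qq'.
have := hd _ _ qq'; have := hd _ _ (le_lt_trans (norm_refl2 l q q') qq').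
rewrite /adiff !ler_norml.
move: (u q) (u q') (u (refl l q)) (u (refl l q')) => A B C D.
by move=> /andP[h1 h2] /andP[h3 h4]; lra.
Qed.

Definition Qmax l (rho : R) := (rho + 2 * l) `^ b.

Lemma Qmax_bound l rho (q : 'rV[R]_n.+1) : 0 < l -> `|q| <= rho ->
  0 <= `|q ord0 ord0 - 2 * l| `^ b <= Qmax l rho.
Proof.
move=> l0 qr; have rho0 : 0 <= rho by exact: le_trans qr.
rewrite powR_ge0/= ge0_ler_powR ?nnegrE ?(ltW b0)//.
  by rewrite addr_ge0// mulr_ge0// ltW.
apply: le_trans (ler_normB _ _) _; apply: lerD.
  exact: le_trans (coord_le_norm _ _) qr.
by rewrite ger0_norm// mulr_ge0// ltW.
Qed.

Definition adiff_nonneg_right l := forall y, l <= y ord0 ord0 -> 0 <= adiff u l y.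

(** A point [x] that minimises [w] up to the cusp, where [w x <= 0]: the nonlocal
    inequality and the equation at [x] and at its mirror image are confronted. The
    cusp is placed over [x1 = 2 * l], the points whose mirror image lies on the plane
    [x1 = 0], because [g_refl] fails exactly there. *)
Section negative_minimum.
Variables (L M : R).
Hypothesis uM : forall x, u x <= M.
Hypothesis fL : forall a b, 0 <= a <= M -> 0 <= b <= M -> `|f a - f b| <= L * `|a - b|.

Variables (l rho : R) (x y : 'rV[R]_n.+1) (r c c2 eps s : R).
Hypotheses (l0 : 0 < l) (Ox : Omega x) (lx : l < x ord0 ord0).
Local Notation w := (adiff u l).
Local Notation d := (x ord0 ord0 - l).
Hypothesis wx : w x <= 0.
Hypothesis rho1 : forall z, Omega z -> `|z| <= rho - 1.
Hypotheses (c0 : 0 < c) (eps0 : 0 <= eps) (s0 : 0 < s).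
Hypotheses (sd : s <= d) (s1 : s <= 1).
Hypothesis Arho : cube y r `<=` cbox rho.
Hypothesis Al : forall q, cube y r q -> l < q ord0 ord0.
Hypothesis Aw : forall q, cube y r q -> 2 * c <= w q.
Hypothesis epsQ : eps * Qmax l rho <= c.
Hypothesis xmin : forall q : 'rV[R]_n.+1, l < q ord0 ord0 -> `|q| <= rho ->
  w x - w q <= - (eps * spike b (2 * l) x q).
Hypothesis hker : forall q : 'rV[R]_n.+1, cube y r q -> 0 < enorm (x - q) ->
  c2 <= ker p x q - ker p x (refl l q).

Lemma negative_minimum_inequality : 0 < eps \/ x ord0 ord0 != 2 * l ->
  L * w x <= eps * (@outer_const R n b + @inner_const R n b)
    + eps * Qmax l rho * s `^ (- p) * fine (mu (cbox rho))
    - c * c2 * fine (mu (cube y r)) + 2 * w x * (@strip_const R n alpha * d `^ (- b)).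
Proof.
case: solu => _ defd eqn _.
have Orx := refl_Omega l0 lx Ox.
have dx := defd _ Ox; have drx := defd _ Orx.
have rho0 : 0 <= rho by have := le_trans (normr_ge0 x) (rho1 Ox); rewrite subr_ge0; apply: le_trans.
have Q0 : 0 <= Qmax l rho by exact: powR_ge0.
have mB : measurable (cbox rho : set 'rV[R]_n.+1) by exact: measurable_cbox.
have mA : measurable (cube y r) by exact: measurable_obox.
have fB := @mu_cbox_fin R n rho.
have hout q : halfsp l q -> ~ cbox rho q -> 0 <= w q.
  move=> _ nq; apply: adiff_out => /rho1 h; apply: nq.
  by apply: le_trans h _; rewrite gerBl.
have hQ q : cbox rho q -> `|spike b (2 * l) x q| <= Qmax l rho.
  move=> qr; have := Qmax_bound l0 qr.
  have /(Qmax_bound l0) : `|x| <= rho by apply: le_trans (rho1 Ox) _; rewrite gerBl.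
  rewrite /spike; move: (_ `^ _) (_ `^ _) (Qmax _ _) => A B C /andP[A0 A1] /andP[B0 B1].
  by rewrite ler_norml; lra.
have hball q : enorm (x - q) < s -> cbox rho q.
  move=> xq; rewrite /cbox /= -(subrK x q); apply: le_trans (ler_normD _ _) _.
  rewrite -(subrKC 1 rho); apply: lerD; last exact: rho1.
  rewrite distrC; apply: le_trans (norm_le_enorm _) _; apply: le_trans (ltW xq) s1.
have hmin q : halfsp l q -> cbox rho q -> w x - w q <= - (eps * spike b (2 * l) x q).
  by move=> hq; exact: xmin.
have hcont := adiff_continuous_above wx.
move=> heps.
have xl : x ord0 ord0 != 2 * l.
  case: heps => // epsp; apply/negP => /eqP xl.
  exact: (no_spike_minimum halpha lx dx drx wx eps0 s0 Q0 c0 sd mB mA fB hmin hout Al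
    Arho Aw hQ epsQ hball hker hcont epsp xl).
have H := fraclap_diff_le halpha lx dx drx wx eps0 s0 Q0 c0 sd mB mA fB hmin hout Al
    Arho Aw hQ epsQ hball hker hcont (or_intror xl).
apply: le_trans H; rewrite (eqn _ Ox) (eqn _ Orx).
have gg := g_refl l0 lx Ox xl.
have := fL (a := u (refl l x)) (b := u x); rewrite !u_ge0 !uM => /(_ isT isT).
rewrite -/(w x) (ler0_norm wx) ler_norml => /andP[+ _].
by move: (w x) (f _) (f _) (g _) (g _) gg => A B C D E ?; lra.
Qed.

End negative_minimum.
(** Take a point of [Omega] close to its left end. Its mirror image lies beyond
    the right end of [Omega], so [u] vanishes there and [w] is positive. *)
Lemma positive_cube l z : 0 < l -> Omega z ->
  exists (y : 'rV[R]_n.+1) (r c : R), [/\ 0 < r, 0 < c &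
    forall q, cube y r q -> l + r <= q ord0 ord0 /\ c <= adiff u l q].
Proof.
move=> l0 Oz; have [r0 r00 hr] := Omega_radius.
pose S : set R := [set x ord0 ord0 | x in Omega].
have Sbnd : has_ubound S.
  exists r0 => _ [x Ox <-]; apply: le_trans (ler_norm _) _.
  by apply: le_trans (coord_le_norm x ord0) _; apply/ltW/hr.
have supS : has_sup S by split => //; exists (z ord0 ord0); exists z.
have [_ [x Ox <-] hx] := sup_adherent l0 supS.
have leS q : Omega q -> q ord0 ord0 <= sup S by move=> Oq; apply: ub_le_sup => //; exists q.
have symm q : Omega q -> Omega (refl 0 q).
  rewrite [q]pt_eta refl_pt mulr0 sub0r; exact: symOmega.
pose x' := refl 0 x; have Ox' : Omega x' by exact: symm.
pose y := refl l x'.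
have y0 : y ord0 ord0 = 2 * l + x ord0 ord0 by rewrite /y /x' !refl_0; ring.
have S0 : 0 <= sup S.
  have := leS _ Ox; have := leS _ Ox'; rewrite /x' refl_0; lra.
have yS : sup S + l < y ord0 ord0 by rewrite y0; move: hx; lra.
have nOy : ~ Omega y by move=> /leS; move: yS l0; lra.
pose m := u x'; have m0 : 0 < m by exact: posu.
have wy : adiff u l y = m by rewrite /adiff /y reflK (u_out nOy) subr0.
have m40 : 0 < m / 4 by rewrite divr_gt0.
have [d d0 hd] := u_uniform m40.
exists y, (Num.min (d / 2) ((y ord0 ord0 - l) / 2)), (m / 2).
have yl : 0 < y ord0 ord0 - l by move: yS S0; lra.
split; [by rewrite lt_min !divr_gt0|by rewrite divr_gt0|].
move=> q /cubeP hq; split.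
  have := hq ord0; rewrite lt_min => /andP[_].
  have := ge_min ((y ord0 ord0 - l) / 2) (d / 2) ((y ord0 ord0 - l) / 2).
  rewrite lexx orbT; move: (Num.min _ _) => A hA.
  by rewrite ltr_norml => /andP[h1 h2]; lra.
have yq : `|y - q| < d.
  apply: (@le_lt_trans _ _ (d / 2)); last by rewrite ltr_pdivrMr// ltr_pMr// ltr1n.
  apply: norm_le_coord => [|i]; first by rewrite divr_ge0// ltW.
  by have := hq i; rewrite !mxE lt_min => /andP[/ltW].
have := hd _ _ yq; have := hd _ _ (le_lt_trans (norm_refl2 l y q) yq).
move: wy; rewrite /adiff !ler_norml.
move: (u y) (u q) (u (refl l y)) (u (refl l q)) => A B C D.
by move=> h /andP[h1 h2] /andP[h3 h4]; lra.
Qed.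

Lemma adiff_plane l y : y ord0 ord0 = l -> adiff u l y = 0.
Proof.
by move=> yl; rewrite /adiff (refl_fixed yl) subrr.
Qed.

Lemma adiff_nonneg_closed l : (forall l', l < l' -> adiff_nonneg_right l') -> adiff_nonneg_right l.
Proof.
move=> H y; rewrite le_eqVlt => /predU1P[yl|yl]; first by rewrite adiff_plane.
rewrite leNgt; apply/negP => w0.
pose m := - adiff u l y; have m0 : 0 < m by rewrite oppr_gt0.
have m20 : 0 < m / 2 by rewrite divr_gt0.
have [d d0 hd] := u_uniform m20.
pose t := Num.min (d / 4) (y ord0 ord0 - l).
have t0 : 0 < t by rewrite lt_min divr_gt0//= subr_gt0.
have td : t <= d / 4 by rewrite ge_min lexx.
have ty : t <= y ord0 ord0 - l by rewrite ge_min lexx orbT.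
have := H (l + t) _ y; rewrite ltrDl t0 => /(_ isT); rewrite -lerBrDl => /(_ ty).
have : `|refl (l + t) y - refl l y| < d.
  apply: le_lt_trans (norm_refl_refl _ _ _) _.
  by rewrite addrC addKr ger0_norm ?(ltW t0)//; move: td d0; lra.
move=> /hd; rewrite /m /adiff ler_norml; move: m0; rewrite /m /adiff.
by move: (u _) (u _) (u _) => A B C h1 /andP[h2 h3] h4; lra.
Qed.

Lemma narrow_strip_const (K d be L : R) : 0 < K -> 0 < be -> 0 <= L -> 0 < d ->
  d <= (2 * K / (L + 1)) `^ be^-1 -> L + 1 <= 2 * (K * d `^ (- be)).
Proof.
move=> K0 be0 L0' d0 hd.
have L10 : 0 < L + 1 by rewrite ltr_wpDl.
have q0 : 0 <= 2 * K / (L + 1) by rewrite divr_ge0 ?mulr_ge0 ?ltW.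
have h : d `^ be <= 2 * K / (L + 1).
  rewrite [leRHS](_ : _ = ((2 * K / (L + 1)) `^ be^-1) `^ be).
    by rewrite ge0_ler_powR ?nnegrE ?powR_ge0 ?(ltW be0) ?(ltW d0).
  by rewrite -powRrM mulVf ?gt_eqF// powRr1.
rewrite powRN mulrA ler_pdivlMr ?powR_gt0// mulrC -ler_pdivlMr//.
Qed.

(** Let [w] be negative somewhere for some [l] slightly smaller than [l0], and
    minimise it up to a small cusp. If the minimum is at distance at most [dl] from
    the plane, the zeroth order term beats the Lipschitz constant. Otherwise the
    gain on the cube where [w] is positive is bounded below, whereas [w] itself is
    bounded below by [- sig], which is small by uniform continuity. *)
Lemma adiff_nonneg_open l0 : 0 < l0 -> adiff_nonneg_right l0 ->
  exists2 eta : R, 0 < eta & forall l, 0 < l -> l0 - eta < l -> l <= l0 -> adiff_nonneg_right l.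
Proof.
move=> l00 Pl0.
have [[z Oz]|noO] := pselect (exists z, Omega z); last first.
  exists 1 => // l _ _ _ y _; have out q : ~ Omega q by move=> Oq; apply: noO; exists q.
  exact: adiff_out.
have [y [r [c4 [r0 c40 hcube]]]] := positive_cube l00 Oz.
have [R0 R00 hR] := Omega_radius.
have [M uM] := u_bounded.
have [L L0 fL] := lipschitz_segment M lipf.
pose c := c4 / 4; have c0 : 0 < c by rewrite divr_gt0.
pose rho := Num.max (R0 + 1) (`|y| + r).
have rho1 q : Omega q -> `|q| <= rho - 1.
  by move=> Oq; rewrite lerBrDr le_max lerD2r (ltW (hR _ Oq)).
have Arho : cube y r `<=` cbox rho by apply: cube_cbox => //; rewrite le_max lexx orbT.
have rho0 : 0 < rho by rewrite lt_max addr_gt0.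
pose volA := fine (mu (cube y r)).
have volA0 : 0 < volA by rewrite /volA mu_cube ?(ltW r0)//= exprn_gt0// mulr_gt0.
(* below this distance, 2 * strip_const * d `^ (- b) is at least L + 1 *)
pose dl := (2 * @strip_const R n alpha / (L + 1)) `^ b^-1.
have kap0 : 0 < @strip_const R n alpha by exact: strip_const_gt0.
have L10 : 0 < L + 1 by rewrite ltr_wpDl.
have dl0 : 0 < dl by rewrite powR_gt0// divr_gt0// mulr_gt0.
pose S := n.+1%:R * (2 * rho).
have S0 : 0 < S by rewrite !mulr_gt0.
have boxS (q q' : 'rV[R]_n.+1) : `|q| <= rho -> `|q'| <= rho -> enorm (q - q') <= S.
  by apply: enorm_cbox; exact: ltW.
have h0 : 0 < 4 * dl * r by rewrite !mulr_gt0.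
pose c2 := kernel_gap p S (4 * dl * r).
have c20 : 0 < c2 by exact: kernel_gap_gt0.
pose K := c * c2 * volA; have K0 : 0 < K.
  by apply: mulr_gt0 => //; apply: mulr_gt0.
(* sig keeps w >= 2 * c on the cube, and L * sig below a quarter of the gain K *)
pose sig := Num.min (2 * c) (K / (4 * (L + 1))).
have sig0 : 0 < sig by rewrite lt_min mulr_gt0//= divr_gt0// mulr_gt0.
have sigc : sig <= 2 * c by rewrite ge_min lexx.
have sigK : L * sig <= K / 4.
  apply: (@le_trans _ _ ((L + 1) * (K / (4 * (L + 1))))); last first.
    by rewrite le_eqVlt; apply/orP; left; apply/eqP; field; rewrite gt_eqF.
  by apply: ler_pM => //; [exact: ltW|rewrite lerDl|rewrite ge_min lexx orbT].
have [ds ds0 hds] := u_uniform sig0.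
exists (ds / 2); first by rewrite divr_gt0.
move=> l lp ll0 ll y1 ly1; rewrite leNgt; apply/negP => w1.
have close q : `|adiff u l q - adiff u l0 q| <= sig.
  rewrite /adiff [X in `|X|](_ : _ = u (refl l q) - u (refl l0 q)); last by ring.
  apply: hds; apply: le_lt_trans (norm_refl_refl _ _ _) _.
  by rewrite ler0_norm ?subr_le0//; move: ll0; lra.
have wlow (q : 'rV[R]_n.+1) : l <= q ord0 ord0 -> - sig <= adiff u l q.
  move=> lq; have [l0q|ql0] := leP l0 (q ord0 ord0).
    have := close q; have := Pl0 _ l0q; rewrite ler_norml.
    by move: (adiff _ _ _) (adiff _ _ _) => A B h /andP[h1 _]; lra.
  have /hds : `|refl l q - q| < ds.
    apply: le_lt_trans (norm_refl_id _ _) _.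
    by rewrite ger0_norm ?subr_ge0//; move: ll0 ql0; lra.
  by rewrite ler_norml /adiff => /andP[].
have Aw q : cube y r q -> 2 * c <= adiff u l q.
  move=> /hcube[_ h]; have := close q; rewrite ler_norml => /andP[h1 _].
  have h2 : c4 = 4 * c by rewrite /c; field.
  by move: h h1; rewrite h2; move: (adiff _ _ _) (adiff _ _ _) sigc => A B h3; lra.
have Al (q : 'rV[R]_n.+1) : cube y r q -> l < q ord0 ord0.
  by move=> /hcube[h _]; apply: le_lt_trans ll _; apply: lt_le_trans h; rewrite ltrDl.
pose m := - adiff u l y1; have m0 : 0 < m by rewrite oppr_gt0.
have m40 : 0 < m / 4 by rewrite divr_gt0.
have Oy1 : Omega y1.
  by apply: contrapT => /(adiff_out l); rewrite leNgt w1.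
have [dm dm0 hdm] := u_uniform m40.
(* where w <= - (3 / 4) * m, a point is at distance at least dm / 2 from the plane *)
pose s := Num.min (dm / 2) 1.
have s0 : 0 < s by rewrite lt_min divr_gt0//= ltr01.
have s1 : s <= 1 by rewrite ge_min lexx orbT.
pose Q := Qmax l rho.
have Q0 : 0 < Q by rewrite powR_gt0// addr_gt0// mulr_gt0.
pose X := (@outer_const R n b + @inner_const R n b) + Q * s `^ (- p) * fine (mu (cbox rho)).
pose CC := `|X| + 1.
have CC0 : 0 < CC by rewrite ltr_wpDl.
pose mm := Num.min (m / 4) (Num.min c (K / 4)).
have mm0 : 0 < mm by rewrite !lt_min m40 c0 divr_gt0.
have [mm1 mm2 mm3] : [/\ mm <= m / 4, mm <= c & mm <= K / 4].
  by rewrite !ge_min !lexx !orbT.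
have QC0 : 0 < Q + CC by rewrite addr_gt0.
(* the size of the cusp: eps * Q and eps * CC are both at most mm *)
pose eps := mm / (Q + CC).
have eps0 : 0 < eps by rewrite divr_gt0.
have epsQC : eps * Q + eps * CC = mm by rewrite -mulrDr /eps divfK// gt_eqF.
have epsQ : eps * Q <= mm by rewrite -epsQC lerDl mulr_ge0// ltW.
have epsC : eps * CC <= mm by rewrite -epsQC lerDr mulr_ge0// ltW.
pose F q := adiff u l q - eps * `|q ord0 ord0 - 2 * l| `^ b.
have cF : continuous F.
  have cw := @adiff_continuous l.
  have cp : continuous (fun q : 'rV[R]_n.+1 => `|q ord0 ord0 - 2 * l| `^ b).
    move=> q.
    apply: (@continuous_comp _ _ _ (fun q : 'rV[R]_n.+1 => q ord0 ord0)
      (fun t : R => `|t - 2 * l| `^ b)).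
      exact: coord_continuous.
    exact: continuous_norm_powR.
  move=> q; apply: continuousB; first exact: cw.
  by apply: continuousM; [exact: cst_continuous|exact: cp].
have y1rho : `|y1| <= rho by apply: le_trans (rho1 _ Oy1) _; rewrite gerBl.
have [x [xr xl xF]] := half_box_min cF y1rho ly1.
have wx2 : adiff u l x <= - (3 / 4 * m).
  have h1 := xF _ y1rho ly1; rewrite /F in h1.
  have /andP[a1 a2] := Qmax_bound lp xr; have /andP[a3 a4] := Qmax_bound lp y1rho.
  have e1 : eps * `|x ord0 ord0 - 2 * l| `^ b <= eps * Q by apply: ler_wpM2l => //; exact: ltW.
  have e2 : 0 <= eps * `|y1 ord0 ord0 - 2 * l| `^ b by rewrite mulr_ge0// ltW.
  have e3 := le_trans (le_trans e1 epsQ) mm1.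
  move: h1; rewrite -[adiff u l y1]opprK -/m => h1.
  exact: arith_min h1 e2 e3.
have wx : adiff u l x <= 0 by apply: le_trans wx2 _; rewrite oppr_le0 mulr_ge0// ltW.
have wxn : adiff u l x < 0 by apply: le_lt_trans wx2 _; rewrite oppr_lt0 mulr_gt0.
have Ox : Omega x by apply: contrapT => /(adiff_out l); rewrite leNgt wxn.
have lx : l < x ord0 ord0.
  rewrite lt_neqAle xl andbT; apply/eqP => E.
  by move: wxn; rewrite (adiff_plane (esym E)) ltxx.
have sd : s <= x ord0 ord0 - l.
  apply: (@le_trans _ _ (dm / 2)); first by rewrite ge_min lexx.
  rewrite leNgt; apply/negP => h.
  have /hdm : `|refl l x - x| < dm.
    apply: le_lt_trans (norm_refl_id _ _) _.
    by rewrite ger0_norm ?subr_ge0// mulrC -ltr_pdivlMr.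
  rewrite -/(adiff u l x) ler_norml => /andP[+ _].
  by move=> h1; exact: arith_close wx2 m0 h1.
have xmin (q : 'rV[R]_n.+1) : l < q ord0 ord0 -> `|q| <= rho ->
  adiff u l x - adiff u l q <= - (eps * spike b (2 * l) x q).
  move=> lq qr; have := xF _ qr (ltW lq); rewrite /F /spike mulrBr.
  exact: arith_spike.
have epsQc : eps * Qmax l rho <= c by exact: le_trans epsQ mm2.
have epsCC : eps * (@outer_const R n b + @inner_const R n b)
    + eps * Q * s `^ (- p) * fine (mu (cbox rho)) <= mm.
  rewrite (_ : _ + _ = eps * X); last by rewrite /X [RHS]mulrDr !mulrA.
  apply: le_trans epsC; apply: ler_wpM2l; first exact: ltW.
  by apply: le_trans (ler_norm X) _; rewrite /CC lerDl.
set DD := x ord0 ord0 - l in sd.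
have DD0 : 0 < DD by rewrite subr_gt0.
have [ddl|ddl] := leP DD dl.
  have hker0 (q : 'rV[R]_n.+1) : cube y r q -> 0 < enorm (x - q) ->
      0 <= ker p x q - ker p x (refl l q).
    move=> /Al lq xq; rewrite subr_ge0; exact: ker_anti (ltW lx) (ltW lq) xq.
  have H := negative_minimum_inequality uM fL lp Ox lx wx rho1 c0 (ltW eps0)
    s0 sd s1 Arho Al Aw epsQc xmin hker0 (or_introl eps0).
  have nar := narrow_strip_const kap0 b0 L0 DD0 ddl.
  move: H; rewrite mulr0 mul0r subr0 -/DD.
  have nar' : 2 * adiff u l x * (@strip_const R n alpha * DD `^ (- b)) <= adiff u l x * (L + 1).
    by rewrite -mulrA mulrCA; apply: ler_wnM2l.
  by move=> H; exact: arith_narrow H epsCC nar' wx2 m0 mm1.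
have hkerg (q : 'rV[R]_n.+1) : cube y r q -> 0 < enorm (x - q) ->
    c2 <= ker p x q - ker p x (refl l q).
  move=> hq xq; apply: ker_diff_ge => //; first by apply: boxS => //; exact: Arho.
  have [lq _] := hcube _ hq.
  apply: ler_pM => //; [by rewrite mulr_ge0// ltW|exact: ltW| |].
    by apply: ler_wpM2l => //; exact: ltW.
  by move: lq ll0; lra.
have H := negative_minimum_inequality uM fL lp Ox lx wx rho1 c0 (ltW eps0)
  s0 sd s1 Arho Al Aw epsQc xmin hkerg (or_introl eps0).
have neg : 2 * adiff u l x * (@strip_const R n alpha * DD `^ (- b)) <= 0.
  apply: mulr_le0_ge0; first by rewrite pmulr_rle0.
  by rewrite mulr_ge0 ?powR_ge0// ltW.
have Lw : - (K / 4) <= L * adiff u l x.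
  apply: (@le_trans _ _ (L * (- sig))); first by rewrite mulrN lerN2.
  by apply: ler_wpM2l => //; exact: wlow.
move: H; rewrite -/volA -/K -/DD => H.
exact: arith_wide H epsCC neg Lw mm3 K0.
Qed.

Lemma adiff_nonneg_all l : 0 < l -> adiff_nonneg_right l.
Proof.
have [R0 R00 hR] := Omega_radius.
pose E : set R := [set l | 0 < l /\ forall l', l <= l' -> adiff_nonneg_right l'].
have ER : E R0.
  split=> // l' Rl' y ly; apply: adiff_out => /hR; rewrite ltNge => /negP; apply.
  apply: le_trans Rl' _; apply: le_trans ly _.
  by apply: le_trans (ler_norm _) _; exact: coord_le_norm.
have infE : has_inf E by split; [exists R0|exists 0 => e [/ltW]].
have Elt l' : inf E < l' -> adiff_nonneg_right l'.
  rewrite -subr_gt0 => h; have [e [_ Ee]] := inf_adherent h infE.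
  by rewrite addrC subrK => /ltW; exact: Ee.
suff i0 : inf E <= 0 by move=> l0; apply: Elt; exact: le_lt_trans i0 l0.
rewrite leNgt; apply/negP => i0.
have [eta eta0 heta] := adiff_nonneg_open i0 (adiff_nonneg_closed Elt).
pose l1 := Num.max (inf E / 2) (inf E - eta / 2).
have l10 : 0 < l1 by rewrite lt_max divr_gt0.
have l1i : l1 < inf E.
  rewrite gt_max; apply/andP; split; first by rewrite ltr_pdivrMr// ltr_pMr// ltr1n.
  by rewrite ltrBlDr ltrDl divr_gt0.
have El1 : E l1.
  split=> // l' ll'; have [l'i|] := leP l' (inf E); last exact: Elt.
  apply: heta => //; first exact: lt_le_trans ll'.
  apply: lt_le_trans ll'; rewrite lt_max; apply/orP; right.
  by rewrite ltrD2l ltrN2 ltr_pdivrMr// ltr_pMr// ltr1n.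
have /(ge_inf _) : E l1 by [].
by case: infE => _ lbE => /(_ lbE); rewrite leNgt l1i.
Qed.

Lemma adiff_nonneg_zero : adiff_nonneg_right 0.
Proof. by apply: adiff_nonneg_closed; exact: adiff_nonneg_all. Qed.

(** Strong maximum principle: at a zero of [w] the two sides of the equation
    agree up to the sign of the difference of [g], while the nonlocal operator is
    negative because of the cube where [w] is positive. As [0 < x1], the mirror image
    is off the plane [x1 = 0] and no cusp is needed. *)
Lemma strictly_decreasing_solution : strictly_decreasing_x1 Omega u.
Proof.
move=> x1 y1 x' Ox1 Oy1 x10 xy1.
pose l := (x1 + y1) / 2; pose x := pt y1 x'.
have x0E : x ord0 ord0 = y1 by exact: pt0.
have rx : refl l x = pt x1 x' by rewrite /x refl_pt; congr pt; rewrite /l; field.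
have lp : 0 < l by rewrite /l; lra.
have lx : l < x ord0 ord0 by rewrite x0E /l; lra.
have Pl := adiff_nonneg_all lp.
rewrite -rx -subr_gt0 -/(adiff u l x) ltNge; apply/negP => wx.
have w0 : adiff u l x = 0 by apply/eqP; rewrite eq_le wx Pl// ltW.
have Ox : Omega x by [].
have [y [r [c4 [r0 c40 hcube]]]] := positive_cube lp Ox.
have [R0 R00 hR] := Omega_radius.
have [M uM] := u_bounded.
have [L L0 fL] := lipschitz_segment M lipf.
pose c := c4 / 2; have c0 : 0 < c by rewrite divr_gt0.
pose rho := Num.max (R0 + 1) (`|y| + r).
have rho1 q : Omega q -> `|q| <= rho - 1.
  by move=> Oq; rewrite lerBrDr le_max lerD2r (ltW (hR _ Oq)).
have Arho : cube y r `<=` cbox rho by apply: cube_cbox => //; rewrite le_max lexx orbT.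
have rho0 : 0 < rho by rewrite lt_max addr_gt0.
have volA0 : 0 < fine (mu (cube y r)).
  by rewrite mu_cube ?(ltW r0)//= exprn_gt0// mulr_gt0.
have S0 : 0 < n.+1%:R * (2 * rho) by rewrite !mulr_gt0.
have d0 : 0 < x ord0 ord0 - l by rewrite subr_gt0.
have h0 : 0 < 4 * (x ord0 ord0 - l) * r by rewrite !mulr_gt0.
pose c2 := kernel_gap p (n.+1%:R * (2 * rho)) (4 * (x ord0 ord0 - l) * r).
have c20 : 0 < c2 by exact: kernel_gap_gt0.
have Al (q : 'rV[R]_n.+1) : cube y r q -> l < q ord0 ord0.
  by move=> /hcube[h _]; apply: lt_le_trans h; rewrite ltrDl.
have Aw q : cube y r q -> 2 * c <= adiff u l q.
  by move=> /hcube[_]; rewrite /c mulrC divfK.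
have xrho : `|x| <= rho by apply: le_trans (rho1 _ Ox) _; rewrite gerBl.
have hker (q : 'rV[R]_n.+1) : cube y r q -> 0 < enorm (x - q) ->
    c2 <= ker p x q - ker p x (refl l q).
  move=> hq xq; apply: ker_diff_ge => //.
    by apply: enorm_cbox; [exact: ltW|exact: xrho|exact: Arho].
  have [lq _] := hcube _ hq.
  by apply: ler_wpM2l; [rewrite mulr_ge0// ltW|rewrite lerBrDl].
have sd : Num.min (x ord0 ord0 - l) 1 <= x ord0 ord0 - l by rewrite ge_min lexx.
have s1 : Num.min (x ord0 ord0 - l) 1 <= 1 by rewrite ge_min lexx orbT.
have s0 : 0 < Num.min (x ord0 ord0 - l) 1 by rewrite lt_min d0 ltr01.
have epsQ : 0 * Qmax l rho <= c by rewrite mul0r ltW.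
have xmin (q : 'rV[R]_n.+1) : l < q ord0 ord0 -> `|q| <= rho ->
    adiff u l x - adiff u l q <= - (0 * spike b (2 * l) x q).
  by move=> lq _; rewrite mul0r oppr0 w0 sub0r oppr_le0; apply: Pl; exact: ltW.
have xl : x ord0 ord0 != 2 * l.
  by rewrite x0E /l; apply/eqP; move: x10; lra.
have := negative_minimum_inequality uM fL lp Ox lx wx rho1 c0 (lexx 0)
  s0 sd s1 Arho Al Aw epsQ xmin hker (or_intror xl).
rewrite w0 !(mul0r, mulr0) !add0r addr0 oppr_ge0 leNgt => /negP; apply.
by apply: mulr_gt0 => //; apply: mulr_gt0.
Qed.

End moving_planes.

(** Applied to the reflected solution, the sign of [w] at [l = 0] gives the opposite
    inequality, hence symmetry. *)
Lemma classical_solution_refl (R : realType) (n : nat) (alpha : R)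
  (Omega : set 'rV[R]_n.+1) (f : R -> R) (g u : 'rV[R]_n.+1 -> R) :
  symmetric_set_x1 Omega -> symmetric_x1 Omega g ->
  classical_solution alpha Omega f g u ->
  classical_solution alpha Omega f g (u \o refl 0).
Proof.
move=> symO symg [cu du eu ou].
have symr x : Omega x -> Omega (refl 0 x).
  rewrite [x]pt_eta refl_pt mulr0 sub0r; exact: symO.
have symr' x : Omega (refl 0 x) -> Omega x by rewrite -{2}[x](reflK 0); exact: symr.
have kE x : fraclap_kernel alpha (u \o refl 0) x =
    fraclap_kernel alpha u (refl 0 x) \o refl 0.
  by apply/funext => y; rewrite /fraclap_kernel /= enorm_refl2.
have iE x (e : R) : Omega x -> 0 < e -> (lebesgue_rV n.+1).-integrable (off_ball x e)
    (EFin \o fraclap_kernel alpha (u \o refl 0) x).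
  move=> /symr/du[/(_ e) i _] /i {}i.
  have := integrable_refl 0 (measurable_off_ball _ _) i.
  by rewrite off_ball_refl kE.
have tE x (e : R) : Omega x -> 0 < e ->
    fraclap_trunc alpha (u \o refl 0) x e = fraclap_trunc alpha u (refl 0 x) e.
  move=> /symr/du[/(_ e) i _] /i {}i.
  have E := Rintegral_refl 0 (measurable_off_ball _ _) i; rewrite off_ball_refl in E.
  by rewrite /fraclap_trunc kE; exact: esym E.
have cE x : Omega x ->
    fraclap_trunc alpha (u \o refl 0) x e @[e --> 0^'+] --> fraclap alpha u (refl 0 x).
  move=> Ox; have [_ c] := du _ (symr _ Ox).
  apply: cvg_trans c; apply: near_eq_cvg; near=> e.
  by rewrite tE//; near: e; exact: nbhs_right_gt.
have fE x : Omega x -> fraclap alpha (u \o refl 0) x = fraclap alpha u (refl 0 x).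
  by move=> /cE/cvg_lim; apply; exact: Rhausdorff.
split.
- move=> x; apply: continuous_comp; last exact: cu.
  exact: refl_continuous.
- move=> x Ox; split; first by move=> e; exact: iE.
  by apply/cvg_ex; eexists; exact: cE.
- move=> x Ox; rewrite fE// eu; last exact: symr.
  congr (_ + _); move: Ox; rewrite [x]pt_eta refl_pt mulr0 sub0r; exact: symg.
- by move=> x nOx; apply: ou => /symr'.
Unshelve. all: by end_near. Qed.

Theorem theorem3p1 (R : realType) (n : nat) (hN : (2 <= n.+1)%N)
  (alpha : R) (halpha : 0 < alpha < 1)
  (Omega : set 'rV[R]_n.+1)
  (openOmega : open Omega) (bndOmega : bounded_set Omega)
  (convOmega : convex_x1 Omega) (symOmega : symmetric_set_x1 Omega)
  (f : R -> R) (lipf : [locally [lipschitz f t | t in [set t : R | 0 <= t]]])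
  (g : 'rV[R]_n.+1 -> R)
  (symg : symmetric_x1 Omega g) (decg : decreasing_x1 Omega g)
  (u : 'rV[R]_n.+1 -> R)
  (solu : classical_solution alpha Omega f g u)
  (posu : forall x, Omega x -> 0 < u x) :
  symmetric_x1 [set: 'rV[R]_n.+1] u /\ strictly_decreasing_x1 Omega u.
Proof.
split; last first.
  exact: strictly_decreasing_solution halpha bndOmega convOmega symOmega lipf symg decg
    solu posu.
have h1 := adiff_nonneg_zero halpha bndOmega convOmega symOmega lipf symg decg solu posu.
have posv x : Omega x -> 0 < (u \o refl 0) x.
  by move=> Ox; apply: posu; move: Ox; rewrite [x]pt_eta refl_pt mulr0 sub0r; exact: symOmega.
have h2 := adiff_nonneg_zero halpha bndOmega convOmega symOmega lipf symg decg
  (classical_solution_refl symOmega symg solu) posv.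
have key (y : 'rV[R]_n.+1) : 0 <= y ord0 ord0 -> u (refl 0 y) = u y.
  move=> y0; have := h1 _ y0; have := h2 _ y0; rewrite /adiff /= reflK !subr_ge0 => a1 a2.
  by apply/eqP; rewrite eq_le a1 a2.
move=> x1 x' _; have E a : pt (- a) x' = refl 0 (pt a x').
  by rewrite refl_pt mulr0 sub0r.
have [x10|/ltW x10] := leP 0 x1; first by rewrite E key// pt0.
rewrite -[in RHS](opprK x1) [in RHS]E key// pt0 oppr_ge0//.
Qed.
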